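(* Let $(X,\|\cdot\|)$ be a uniformly convex Banach space, let $\Omega\subset X$ be a symmetric convex domain with quasihyperbolic metric $k=k_\Omega$, and let $B=\mathbf B_k(0,r)$ for some $r>0$. Then the equivalent norm $M_B$ on $X$ is uniformly convex. Moreover, any equivalent norm on $X$ can be approximated uniformly on bounded sets by uniformly convex norms arising from such quasihyperbolic balls: for every equivalent norm $|||\cdot|||$ on $X$, every bounded set $S\subset X$ and every $\varepsilon>0$ there are a symmetric convex domain $\Omega\subset X$ and $r>0$ such that, with $B=\mathbf B_{k_\Omega}(0,r)$, the norm $M_B$ is uniformly convex and $\sup_{x\in S}\big|M_B(x)-|||x|||\big|\le\varepsilon$.
   Context: Banach spaces are real. A domain $\Omega\subset X$ is an open path-connected subset with non-empty boundary $\partial\Omega$; symmetric means $-\Omega=\Omega$. Write $d(z,\partial\Omega)$ for the $\|\cdot\|$-distance from $z$ to $\partial\Omega$. The quasihyperbolic metric on $\Omega$ (taken with respect to $\|\cdot\|$) is $$k_\Omega(x,y)=\inf_\gamma\int_\gamma\frac{\|dz\|}{d(z,\partial\Omega)},$$ the infimum being over all rectifiable curves $\gamma$ in $\Omega$ joining $x$ and $y$. $\mathbf B_k(0,r)=\{x\in\Omega:k(0,x)\le r\}$. For $B\subset X$, the Minkowski functional is $M_B(x)=\inf\{\lambda>0: x\in\lambda B\}$. *)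

(* Defs.v *)
From mathcomp Require Import all_boot all_order all_algebra.
From mathcomp Require Import all_classical all_reals all_analysis.
Set Implicit Arguments.
Unset Strict Implicit.
Unset Printing Implicit Defensive.
Import Order.TTheory GRing.Theory Num.Theory.
Import numFieldNormedType.Exports.
Local Open Scope classical_set_scope.
Local Open Scope ring_scope.

Definition is_norm (R : realType) (X : normedModType R) (N : X -> R) : Prop :=
  [/\ forall x y, N (x + y) <= N x + N y,
      forall (a : R) x, N (a *: x) = `|a| * N x
    & forall x, N x = 0 -> x = 0].

Definition equivalent_norm (R : realType) (X : normedModType R) (N : X -> R) : Prop :=
  is_norm N /\
  exists c C : R, [/\ 0 < c, 0 < C & forall x, c * `|x| <= N x <= C * `|x|].

Definition uniformly_convex (R : realType) (X : normedModType R) (N : X -> R) : Prop :=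
  forall eps : R, 0 < eps -> exists2 delta : R, 0 < delta &
    forall x y : X, N x = 1 -> N y = 1 -> eps <= N (x - y) ->
      N (2^-1 *: (x + y)) <= 1 - delta.

Definition boundary (T : topologicalType) (A : set T) : set T :=
  closure A `\` interior A.

Definition path_connected (R : realType) (X : normedModType R) (A : set X) : Prop :=
  forall x y, A x -> A y -> exists gamma : R -> X,
    [/\ {within `[0, 1], continuous gamma}, gamma 0 = x, gamma 1 = y
      & gamma @` `[0, 1] `<=` A].

(* Nonemptiness of [Omega] is a consequence of that of its boundary. *)
Definition domain (R : realType) (X : normedModType R) (Omega : set X) : Prop :=
  [/\ open Omega, path_connected Omega & boundary Omega !=set0].

Definition symmetric_set (R : realType) (X : normedModType R) (A : set X) : Prop :=
  [set - x | x in A] = A.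

Definition boundary_dist (R : realType) (X : normedModType R) (Omega : set X)
    (z : X) : R :=
  inf [set `|z - w| | w in boundary Omega].

(* The library's [total_variation] is restricted to real-valued functions;
   here [s] enumerates the points after [a] of a subdivision of [a, b]. *)
Definition curve_length (R : realType) (X : normedModType R) (a b : R)
    (gamma : R -> X) : \bar R :=
  ereal_sup [set (\sum_(0 <= i < size s)
      `|gamma (nth b (a :: s) i.+1) - gamma (nth b (a :: s) i)|)%:E
    | s in itv_partition a b].

(* Curves are parametrized by [0, 1]. *)
Definition rectifiable_curve (R : realType) (X : normedModType R) (Omega : set X)
    (x y : X) (gamma : R -> X) : Prop :=
  [/\ {within `[0, 1], continuous gamma}, gamma 0 = x, gamma 1 = y,
      gamma @` `[0, 1] `<=` Omega
    & (curve_length 0%R 1%R gamma < +oo)%E].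

(* The arc-length parametrization, on [0, length of gamma]: the point of gamma
   at the first parameter by which the arc length [u] has been covered. *)
Definition arclength_param (R : realType) (X : normedModType R) (gamma : R -> X)
    (u : R) : X :=
  gamma (inf [set t | 0 <= t <= 1 /\ (u%:E <= curve_length 0%R t gamma)%E]).

(* The integral of [f] along a rectifiable curve with respect to ||dz||. *)
Definition line_integral (R : realType) (X : normedModType R) (gamma : R -> X)
    (f : X -> R) : \bar R :=
  (\int[lebesgue_measure]_(u in `[0%R, fine (curve_length 0%R 1%R gamma)])
     (f (arclength_param gamma u))%:E)%E.

Definition quasihyperbolic (R : realType) (X : normedModType R) (Omega : set X)
    (x y : X) : \bar R :=
  ereal_inf [set line_integral gamma (fun z => (boundary_dist Omega z)^-1)
    | gamma in rectifiable_curve Omega x y].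

Definition quasihyperbolic_ball (R : realType) (X : normedModType R)
    (Omega : set X) (r : R) : set X :=
  [set x | Omega x /\ (quasihyperbolic Omega 0%R x <= r%:E)%E].

Definition minkowski_functional (R : realType) (X : normedModType R) (B : set X)
    (x : X) : R :=
  inf [set l : R | 0 < l /\ [set l *: b | b in B] x].

(* Main.v *)
Require Import Defs.
From mathcomp Require Import all_boot all_order all_algebra.
From mathcomp Require Import all_classical all_reals all_analysis.
From mathcomp Require Import measurable_realfun.
From mathcomp Require Import ring lra.
Import Order.TTheory GRing.Theory Num.Theory.
Import numFieldNormedType.Exports.
Local Open Scope classical_set_scope.
Local Open Scope ring_scope.
Set Implicit Arguments.
Unset Strict Implicit.
Unset Printing Implicit Defensive.

(** Write d for the distance to the boundary and k for the quasihyperbolic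
metric.  On a convex domain d is concave, so averaging two curves gamma_1 and
gamma_2 on [0, r] that issue from 0 and satisfy |gamma_i'| <= d(gamma_i) gives
a curve with the same property; this is why the balls of k centred at 0 are convex.
In a uniformly convex space the average does strictly better wherever the
rescaled velocities gamma_i' / d(gamma_i) are far apart.  And they must be far
apart for a substantial amount of time if the end points are at distance at
least eps: where the rescaled velocities almost agree, the velocities differ by
little more than |d(gamma_1) - d(gamma_2)| <= |gamma_1 - gamma_2|, and
Gronwall's inequality keeps the two curves together.  The midpoint of two
points of the ball that are eps apart therefore has k-distance to 0 at most
r - eta, with eta independent of the two points, so that it stays in the ball
when it is stretched by a fixed factor 1 + delta.  For the Minkowski functional this is
uniform convexity.

The argument is carried out on discrete curves, the chains of points with
|p_(i+1) - p_i| <= c d(p_i) ([fine_chain]), for which the velocities are just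
the steps divided by c.  Two estimates link chains to curves.
[quasihyperbolic_chain] cuts a curve greedily, each piece having arc length
c d(p_i): as d is 1-Lipschitz, such a piece has quasihyperbolic length at least
c / (1 + c), hence n pieces are enough as soon as n c / (1 + c) reaches the
quasihyperbolic length of the curve.  Conversely [quasihyperbolic_le_chain]
bounds the length of the polygon through p_0, ..., p_n by the sum of
w_i / (1 - w_i), if w_i is the size of step i relative to d(p_i).  Both
c / (1 + c) and c / (1 - c) are c + O(c^2), so the errors vanish as n tends to
infinity with n c bounded; this is quantified in [fine_parameters].  The
discrete Gronwall argument is [midpoint_chain_gain], and [ball_midpoint] is its
translation to balls.

For the approximation of an equivalent norm N, take for the domain the open
unit ball of N.  A point x with N x <= 1 - eta can be reached from 0 along the
segment [0, x], on which d is bounded below, so that the quasihyperbolic ball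
of a suitable radius lies between (1 - eta) times the unit ball and the unit
ball itself ([minkowski_norm_ball]). *)

(** * The distance to the boundary of a convex domain *)

Section BoundaryDistance.
Context {R : realType} {X : normedModType R}.
Implicit Types (Omega : set X) (x y z w : X).

(** Convexity with real coefficients, free of the bundled coefficients of
    [convex_set]. *)
Definition has_segments Omega := forall x y (t : R), 0 <= t <= 1 ->
  Omega x -> Omega y -> Omega (t *: x + (1 - t) *: y).

Lemma convex_set_segments Omega : convex_set Omega <-> has_segments Omega.
Proof.
split=> cO x y t.
- move=> t01 Ox Oy.
  have i01 : Itv.spec (@Itv.num_sem R) (Itv.Real `[0%Z, 1%Z]) t.
    by rewrite /Itv.spec/= /Itv.num_sem/= num_real/= in_itv/=.
  have := cO x y (Itv.mk i01); rewrite !inE => /(_ Ox Oy).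
  by rewrite /conv/=.
- rewrite !inE => Ox Oy; apply: (cO x y t%:num) => //.
  by apply/andP; split.
Qed.

Lemma midpoint_conv x y :
  2^-1 *: x + (1 - 2^-1 : R) *: y = (2^-1 : R) *: (x + y).
Proof. by rewrite scalerDr; congr (_ + _ *: _); field. Qed.

Lemma boundary_notin Omega w : open Omega -> boundary Omega w -> ~ Omega w.
Proof. by move=> /interior_id oO [_]; rewrite oO. Qed.

Lemma boundary_dist_le Omega z w : boundary Omega w ->
  boundary_dist Omega z <= `|z - w|.
Proof.
move=> bw; apply: ge_inf; last by exists w.
by exists 0 => _ [? _ <-].
Qed.

Lemma boundary_dist_ge Omega z (m : R) : boundary Omega !=set0 ->
  (forall w, boundary Omega w -> m <= `|z - w|) -> m <= boundary_dist Omega z.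
Proof.
move=> [b bb] H; apply: lb_le_inf; first by exists `|z - b|; exists b.
by move=> _ [w bw <-]; exact: H.
Qed.

Lemma boundary_dist_lip Omega z w : boundary Omega !=set0 ->
  boundary_dist Omega z <= boundary_dist Omega w + `|z - w|.
Proof.
move=> b0; rewrite -lerBlDr; apply: boundary_dist_ge => // v bv.
rewrite lerBlDr; apply: le_trans (boundary_dist_le _ bv) _.
by rewrite [leRHS]addrC; exact: ler_distD.
Qed.

Lemma boundary_dist_norm_lip Omega z w : boundary Omega !=set0 ->
  `|boundary_dist Omega z - boundary_dist Omega w| <= `|z - w|.
Proof.
move=> b0; rewrite ler_norml; have := boundary_dist_lip z w b0.
by have := boundary_dist_lip w z b0; rewrite (distrC w); lra.
Qed.

Lemma boundary_dist_opp Omega z : symmetric_set Omega ->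
  boundary Omega !=set0 -> boundary_dist Omega (- z) = boundary_dist Omega z.
Proof.
move=> sO b0.
have sE A x : [set - y | y in A] x <-> A (- x).
  by split=> [[y Ay <-]|Ax]; [rewrite opprK|exists (- x) => //; rewrite opprK].
have bN w : boundary Omega w -> boundary Omega (- w).
  have Nn U : nbhs (- w) U -> nbhs w [set - y | y in U].
    move=> H; have {}H : nbhs w (-%R @^-1` U) by exact: (@opp_continuous X w U H).
    by apply: filterS H => y Uy; exists (- y) => //; exact: opprK.
  move=> [cw iw]; split.
    move=> U /Nn /cw [y [Oy /sE Uy]]; exists (- y); split => //.
    by rewrite -sO; apply/sE; rewrite opprK.
  move=> iNw; apply: iw.
  by have := Nn _ iNw; rewrite sO.
have le x : boundary_dist Omega (- x) <= boundary_dist Omega x.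
  apply: boundary_dist_ge => // w bw.
  by rewrite -normrN opprB addrC -{1}(opprK w); exact/boundary_dist_le/bN.
by apply/eqP; rewrite eq_le le -{1}(opprK z) le.
Qed.

Lemma boundary_dist_gt0 Omega z : open Omega -> boundary Omega !=set0 ->
  Omega z -> 0 < boundary_dist Omega z.
Proof.
move=> oO b0 Oz.
have /nbhs_ballP[e e0 be] : nbhs z Omega by exact: open_nbhs_nbhs.
apply: lt_le_trans e0 _; apply: boundary_dist_ge => // w bw.
rewrite leNgt; apply/negP => zw; apply: boundary_notin bw _ => //.
by apply: be; rewrite -ball_normE.
Qed.

(** A segment that leaves [Omega] meets the boundary: otherwise the part of it
    in [Omega] would be open and closed in the segment. *)
Lemma boundary_dist_ball Omega z w : open Omega -> Omega z ->
  `|z - w| < boundary_dist Omega z -> Omega w.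
Proof.
move=> oO Oz zw.
pose f (t : R) : X := z + t *: (w - z).
have cf : continuous f.
  by move=> t; apply: cvgD; [exact: cvg_cst|apply: cvgZr_tmp; exact: cvg_id].
have nb t : 0 <= t <= 1 -> ~ boundary Omega (f t).
  move=> /andP[t0 t1] /(@boundary_dist_le _ z); apply/negP; rewrite -ltNge.
  apply: le_lt_trans zw; rewrite opprD addrA subrr sub0r normrN normrZ distrC.
  by rewrite ger0_norm// ler_piMl.
have /connected_intervalP cI : is_interval `[(0:R), 1]%classic by exact: interval_is_interval.
suff : (`[0, 1] `&` (f @^-1` Omega))%classic 1.
  by case=> _; rewrite /f/= scale1r addrC subrK.
rewrite (cI (`[0, 1] `&` f @^-1` Omega)) /=; first by rewrite in_itv/= ler01 lexx.
- by exists 0; split; rewrite /= /f ?scale0r ?addr0// in_itv/= lexx ler01.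
- exists (f @^-1` Omega) => //; apply: open_comp => // t _; exact: cf.
- exists (f @^-1` closure Omega) => //.
    apply: closed_comp; [by move=> t _; exact: cf | exact: closed_closure].
  apply/seteqP; split=> t [t01]; rewrite /= => Ot; split => //.
    exact: subset_closure.
  rewrite /= in_itv/= in t01.
  have := nb t t01; rewrite /boundary/setD/= => /not_andP[//|/contrapT].
  exact: interior_subset.
Qed.

(** By convexity, [Omega] contains every average of a point of the ball of
    radius d(x) around x and a point of the ball of radius d(y) around y.  These
    averages fill the ball around t x + (1 - t) y whose radius is the average of
    the two radii. *)
Lemma boundary_dist_concave Omega x y (t : R) : open Omega ->
  has_segments Omega -> boundary Omega !=set0 -> Omega x -> Omega y -> 0 <= t <= 1 ->
  t * boundary_dist Omega x + (1 - t) * boundary_dist Omega y <=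
  boundary_dist Omega (t *: x + (1 - t) *: y).
Proof.
move=> oO cO b0 Ox Oy t01; have /andP[t0 t1] := t01.
apply: boundary_dist_ge => // w bw; rewrite leNgt; apply/negP => Hw.
apply: (boundary_notin oO bw).
set a := boundary_dist Omega x in Hw; set b := boundary_dist Omega y in Hw.
have a0 : 0 < a by exact: boundary_dist_gt0.
have b1 : 0 < b by exact: boundary_dist_gt0.
set m := t *: x + (1 - t) *: y in Hw.
set s := t * a + (1 - t) * b in Hw.
have s0 : 0 < s by apply: le_lt_trans Hw.
have sN0 : s != 0 by rewrite gt_eqF.
(* v is the displacement from m to w in units of the averaged radius; the same
   relative displacement from x and from y averages to w *)
pose v := s^-1 *: (w - m).
have v1 : `|v| < 1.
  by rewrite normrZ gtr0_norm ?invr_gt0// mulrC ltr_pdivrMr// mul1r distrC.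
have -> : w = t *: (x + a *: v) + (1 - t) *: (y + b *: v).
  rewrite !scalerDr !scalerA addrACA -scalerDl -mulrDl -/s -/m divff// scale1r.
  by rewrite addrC subrK.
apply: cO => //; [apply: (boundary_dist_ball oO Ox)|apply: (boundary_dist_ball oO Oy)].
- by rewrite opprD addrA subrr sub0r normrN normrZ gtr0_norm// gtr_pMr.
- by rewrite opprD addrA subrr sub0r normrN normrZ gtr0_norm// gtr_pMr.
Qed.

End BoundaryDistance.

(** * Length of curves *)

Section CurveLength.
Context {R : realType} {X : normedModType R}.
Implicit Types (g : R -> X) (a b x y : R) (s : seq R).

(** Recursive form of the sums in [curve_length], suited to induction on the
    subdivision. *)
Fixpoint polygon_length g a s : R :=
  if s is b :: s' then `|g b - g a| + polygon_length g b s' else 0.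

Lemma polygon_length_sum g a b s :
  \sum_(0 <= i < size s) `|g (nth b (a :: s) i.+1) - g (nth b (a :: s) i)| =
  polygon_length g a s.
Proof.
elim: s a => [|c s IH] a; first by rewrite big_nil.
by rewrite /= big_nat_recl//= -IH.
Qed.

Lemma polygon_length_rcons g a s b :
  polygon_length g a (rcons s b) = polygon_length g a s + `|g b - g (last a s)|.
Proof. by elim: s a => [|c s IH] a /=; rewrite ?addr0 ?add0r// IH addrA. Qed.

Lemma curve_lengthE g a b : curve_length a b g =
  ereal_sup [set (polygon_length g a s)%:E | s in itv_partition a b].
Proof.
congr ereal_sup; apply/seteqP; split=> _ [s ps <-]; exists s => //;
by rewrite polygon_length_sum.
Qed.

Lemma polygon_length_le g a b s : itv_partition a b s ->
  ((polygon_length g a s)%:E <= curve_length a b g)%E.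
Proof. by move=> ps; rewrite curve_lengthE; apply: ereal_sup_ubound; exists s. Qed.

Lemma curve_length_le g a b (l : \bar R) :
  (forall s, itv_partition a b s -> ((polygon_length g a s)%:E <= l)%E) ->
  (curve_length a b g <= l)%E.
Proof.
by move=> H; rewrite curve_lengthE; apply: ge_ereal_sup => _ [s ps <-]; exact: H.
Qed.

Lemma curve_length_ge0 g a b : a <= b -> (0 <= curve_length a b g)%E.
Proof.
rewrite le_eqVlt => /predU1P[->|ab].
  by apply: (@polygon_length_le g b b [::]); split => /=.
apply: le_trans (polygon_length_le g (itv_partition1 ab)).
by rewrite lee_fin/= addr0.
Qed.

Lemma curve_length0 g a : curve_length a a g = 0%E.
Proof.
apply/eqP; rewrite eq_le curve_length_ge0// andbT.
by apply: curve_length_le => s /itv_partitionxx ->.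
Qed.

Lemma curve_length_cons g a c b : a <= c -> c <= b ->
  (`|g c - g a|%:E + curve_length c b g <= curve_length a b g)%E.
Proof.
rewrite le_eqVlt => /predU1P[->|ac] cb.
  by rewrite subrr normr0 add0e.
rewrite -leeBrDl//; apply: curve_length_le => s [ps ls].
rewrite leeBrDl// -EFinD.
apply: (@polygon_length_le g a b (c :: s)); split => //=.
by rewrite ac.
Qed.

Lemma curve_length_rcons g a c b : a <= c -> c <= b ->
  (curve_length a c g + `|g b - g c|%:E <= curve_length a b g)%E.
Proof.
move=> ac; rewrite le_eqVlt => /predU1P[->|cb].
  by rewrite subrr normr0 adde0.
rewrite -leeBrDr//; apply: curve_length_le => s [ps /eqP ls].
rewrite leeBrDr// -EFinD -{1}ls -polygon_length_rcons.
apply: polygon_length_le; split; last by rewrite last_rcons.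
by rewrite rcons_path ps ls.
Qed.

Lemma curve_length_chord g a b : a <= b -> (`|g b - g a|%:E <= curve_length a b g)%E.
Proof.
move=> ab; apply: le_trans (curve_length_rcons g (lexx a) ab).
by rewrite curve_length0 add0e.
Qed.

Lemma curve_length_mono g a c b : a <= c -> c <= b ->
  (curve_length a c g <= curve_length a b g)%E.
Proof.
move=> ac cb; apply: le_trans (curve_length_rcons g ac cb).
by rewrite leeDl.
Qed.

(** A one-sided additivity of arc length: if V controls the increments of g, it
    controls those of its arc length.  A
    subdivision of [a, b] is split at c; the interval that contains c costs
    nothing by the triangle inequality. *)
Lemma curve_length_majorant g (V : R -> R) a b c : a <= c -> c <= b ->
  (forall x y, a <= x -> x <= y -> y <= b -> `|g y - g x| <= V y - V x) ->
  (curve_length a b g <= curve_length a c g + (V b - V c)%:E)%E.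
Proof.
move=> ac cb gV; apply: curve_length_le => s.
elim: s a ac gV => [|y s IH] a ac gV ps.
  have ab := itv_partition_nil ps; have -> : c = b.
    by apply/eqP; rewrite eq_le cb -ab.
  by rewrite subrr adde0; exact/curve_length_ge0/(le_trans ac cb).
have /andP[ay yb] : a < y <= b.
  rewrite (itv_partition_le (itv_partition_cons ps)).
  by case: ps => /= /andP[-> _].
have ps' := itv_partition_cons ps; have ay' := ltW ay.
rewrite /= EFinD; have [yc|cy] := leP y c.
  apply: (@le_trans _ _ (`|g y - g a|%:E + (curve_length y c g + (V b - V c)%:E))%E).
    apply: leeD => //; apply: IH => // u v yu; exact: (gV u v (le_trans ay' yu)).
  by rewrite addeA leeD2r// curve_length_cons.
have H : (curve_length y b g <= (V b - V y)%:E)%E.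
  apply: curve_length_le => {IH ps s ps'} s ps; rewrite lee_fin.
  have {gV} : forall u v, y <= u -> u <= v -> v <= b -> `|g v - g u| <= V v - V u.
    by move=> u v yu; apply: gV; exact: le_trans yu.
  elim: s y {ay yb cy ay'} ps => [|z s IH] y ps gV.
    by rewrite /= (itv_partition_nil ps) subrr.
  have ps' := itv_partition_cons ps.
  have yz : y <= z by case: ps => /= /andP[/ltW ].
  have zb := itv_partition_le ps'.
  rewrite /= (_ : V b - V y = (V z - V y) + (V b - V z)); last by ring.
  apply: lerD; first exact: gV.
  by apply: IH => // u v zu; apply: gV; exact: le_trans zu.
have ca := curve_length_chord g ac.
apply: (@le_trans _ _ (`|g c - g a|%:E + (V b - V c)%:E)%E); last exact: leeD.
apply: (@le_trans _ _ (`|g y - g a|%:E + (V b - V y)%:E)%E).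
  by rewrite leeD2l//; apply: le_trans H; exact: polygon_length_le.
rewrite -!EFinD lee_fin.
have := gV _ _ ac (ltW cy) yb; have := ler_distD (g c) (g y) (g a).
by lra.
Qed.

(** Left lower semicontinuity of the arc length: in an inscribed polygon the
    last vertex can be moved slightly to the left.  It shows that the arc length
    at the first time by which u is reached does not exceed u. *)
Lemma curve_length_lsc g a b (l : R) : a < b ->
  (forall e, 0 < e -> exists2 d, 0 < d & forall x, a <= x -> x < b -> b - d < x ->
     `|g b - g x| < e) ->
  (forall x, a <= x -> x < b -> (curve_length a x g <= l%:E)%E) ->
  (curve_length a b g <= l%:E)%E.
Proof.
move=> ab cg H; apply: curve_length_le => s; elim/last_ind: s => [|s b' _] ps.
  by move: ab; rewrite (itv_partition_nil ps) ltxx.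
have [pp /eqP] := ps; rewrite last_rcons => eb; subst b'.
move: pp; rewrite rcons_path polygon_length_rcons => /andP[pp].
set y := last a s => yb.
have py : itv_partition a y s by split.
have ay := itv_partition_le py.
rewrite lee_fin; apply/ler_addgt0Pr => e e0.
have [d d0 Hd] := cg _ e0.
pose x := Num.max y (b - d / 2).
have yx : y <= x by rewrite le_max lexx.
have xb : x < b by rewrite gt_max yb/=; lra.
have dx : b - d < x.
  apply: (@lt_le_trans _ _ (b - d / 2)); first lra.
  by rewrite le_max lexx orbT.
have ax := le_trans ay yx.
have := le_trans (curve_length_rcons g ay yx) (H _ ax xb).
move/(le_trans (leeD2r _ (polygon_length_le g py))); rewrite -EFinD lee_fin.
have := Hd _ ax xb dx; have := ler_distD (g x) (g b) (g y); lra.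
Qed.

End CurveLength.

(** * Arc-length parametrization and integrals along it *)

Section ArcLength.
Context {R : realType} {X : normedModType R} (g : R -> X).
Hypothesis cg : {within `[0, 1], continuous g}.
Hypothesis rg : (curve_length 0%R 1%R g < +oo)%E.

Let s t := curve_length 0%R t g.
(** The parameter chosen by [arclength_param]. *)
Definition arclength_time (u : R) : R :=
  inf [set t | 0 <= t <= 1 /\ (u%:E <= curve_length 0%R t g)%E].
Let T := arclength_time.
Definition total_length := fine (curve_length 0%R 1%R g).
Let L := total_length.

Lemma total_lengthE : s 1 = L%:E.
Proof. by rewrite /L/total_length fineK// ge0_fin_numE// curve_length_ge0. Qed.

Lemma total_length_ge0 : 0 <= L.
Proof. by rewrite -lee_fin -total_lengthE curve_length_ge0. Qed.

Lemma within_continuous_near t e : 0 <= t <= 1 -> 0 < e ->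
  exists2 d, 0 < d & forall x, 0 <= x <= 1 -> `|t - x| < d -> `|g t - g x| < e.
Proof.
move=> t01 e0.
have /subspace_continuousP/(_ t) := cg; rewrite /= in_itv/= => /(_ t01).
move=> /cvgrPdist_lt/(_ _ e0); rewrite near_withinE => /nbhs_ballP[d d0 H].
exists d => // x x01 tx; apply: H; first by rewrite -ball_normE.
by rewrite /= in_itv.
Qed.

Let Tset u := [set t | 0 <= t <= 1 /\ (u%:E <= s t)%E].
Let Tlb u : has_lbound (Tset u). Proof. by exists 0 => t [/andP[]]. Qed.
Let T1 u : u <= L -> Tset u 1.
Proof. by move=> uL; split; rewrite ?ler01 ?lexx// total_lengthE lee_fin. Qed.

Lemma arclength_time_le u t : 0 <= t <= 1 -> (u%:E <= s t)%E -> T u <= t.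
Proof. by move=> t01 ut; apply: ge_inf; [exact: Tlb | split]. Qed.

Lemma arclength_time_itv u : u <= L -> 0 <= T u <= 1.
Proof.
move=> uL; apply/andP; split.
  by apply: lb_le_inf; [exists 1; exact: T1|move=> t [/andP[]]].
by apply: ge_inf; [exact: Tlb | exact: T1].
Qed.

Lemma arclength_time_lt u t : u <= L -> T u < t -> t <= 1 -> (u%:E <= s t)%E.
Proof.
move=> uL Tt t1.
have [t' [/andP[t'0 _] ut'] t't] : exists2 t', Tset u t' & t' < t.
  by apply: inf_lt => //; exists 1; exact: T1.
by apply: le_trans ut' _; apply: curve_length_mono => //; exact: ltW.
Qed.

Lemma arclength_time_ge u t : u <= L -> t <= 1 -> (s t < u%:E)%E -> t <= T u.
Proof.
by move=> uL t1; rewrite !leNgt => su; apply/negP => /(arclength_time_lt uL)/(_ t1);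
  rewrite leNgt su.
Qed.

Lemma curve_length_arclength_time u : 0 <= u <= L -> (s (T u) <= u%:E)%E.
Proof.
move=> /andP[u0 uL]; have /andP[T0 T1'] := arclength_time_itv uL.
have := T0; rewrite le_eqVlt => /predU1P[<-|T0'].
  by rewrite /s curve_length0 lee_fin.
apply: curve_length_lsc => //.
  move=> e e0; have [|d d0 H] := @within_continuous_near (T u) e _ e0.
    by rewrite T0.
  exists d => // x x0 xT dx; apply: H.
    by rewrite x0/= (le_trans (ltW xT)).
  by rewrite gtr0_norm ?subr_gt0//; lra.
move=> x x0 xT; rewrite leNgt; apply/negP => us.
have : T u <= x.
  by apply: arclength_time_le (ltW us); rewrite x0/= (le_trans (ltW xT)).
by rewrite leNgt xT.
Qed.

(* Any time w after T u has arc length at least u, also as w decreases to T u;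
   by continuity of g the chord from T u to w is then bounded by the difference
   of arc lengths, whether or not the arc length jumps at T u. *)
Let chord_le u w v : u <= L -> T u < w -> w <= 1 -> (s w <= v%:E)%E ->
  `|g w - g (T u)| <= v - u.
Proof.
move=> uL Tw w1 sw; have /andP[T0 T1'] := arclength_time_itv uL.
apply/ler_addgt0Pr => e e0.
have [|d d0 H] := @within_continuous_near (T u) e _ e0; first by rewrite T0.
pose t := Num.min w (T u + d / 2).
have Tt : T u < t by rewrite lt_min Tw/=; lra.
have tw : t <= w by rewrite ge_min lexx.
have td : t <= T u + d / 2 by rewrite ge_min lexx orbT.
have t0 : 0 <= t by rewrite ltW// (le_lt_trans T0).
have ut := arclength_time_lt uL Tt (le_trans tw w1).
have := le_trans (curve_length_rcons g t0 tw) sw.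
move/(le_trans (leeD2r _ ut)); rewrite -EFinD lee_fin.
have : `|g (T u) - g t| < e.
  apply: H; first by rewrite t0 (le_trans tw).
  by rewrite distrC gtr0_norm ?subr_gt0//; lra.
have := ler_distD (g t) (g w) (g (T u)); rewrite [in X in X -> _](distrC (g t) (g (T u))).
by lra.
Qed.

Lemma arclength_param_lip u v : 0 <= u -> u <= v -> v <= L ->
  `|arclength_param g v - arclength_param g u| <= v - u.
Proof.
move=> u0 uv vL; rewrite /arclength_param -/(arclength_time _) -/(arclength_time _) -/T.
have uL := le_trans uv vL; have v0 := le_trans u0 uv.
have sv : (s (T v) <= v%:E)%E by apply: curve_length_arclength_time; rewrite v0.
have /andP[_ Tv1] := arclength_time_itv vL.
have [Tuv|] := ltP (T u) (T v); first exact: chord_le.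
rewrite le_eqVlt => /predU1P[->|Tvu]; first by rewrite subrr normr0 subr_ge0.
exfalso; have /andP[_ Tu1] := arclength_time_itv uL.
pose t := (T v + T u) / 2.
have tT : t < T u by rewrite /t; lra.
have Tt : T v < t by rewrite /t; lra.
have t1 : t <= 1 by rewrite ltW// (lt_le_trans tT).
have /andP[Tv0 _] := arclength_time_itv vL.
have : (u%:E <= s t)%E.
  by apply: le_trans (arclength_time_lt vL Tt t1); rewrite lee_fin.
move/(@arclength_time_le u t); rewrite t1 (le_trans Tv0 (ltW Tt)) => /(_ isT).
by rewrite leNgt tT.
Qed.

Lemma arclength_param0 : arclength_param g 0 = g 0.
Proof.
congr g; apply/eqP; rewrite eq_le; apply/andP; split.
  by apply: arclength_time_le; rewrite ?lexx ?ler01// /s curve_length0.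
by case/andP: (arclength_time_itv total_length_ge0).
Qed.

Lemma arclength_paramL : arclength_param g L = g 1.
Proof.
rewrite /arclength_param -/(arclength_time _) -/T.
have /andP[_] := arclength_time_itv (lexx L).
rewrite le_eqVlt => /predU1P[-> //|TL]; apply/esym/eqP; rewrite -subr_eq0 -normr_le0.
rewrite -(subrr L); apply: chord_le => //; by rewrite total_lengthE.
Qed.

End ArcLength.

Section IntegralBounds.
Context {R : realType} (L : R) (f : R -> R).
Hypothesis mf : measurable_fun `[0%R, L] f.
Hypothesis f0 : forall u, 0 <= u <= L -> 0 <= f u.
Local Notation mu := (@lebesgue_measure R).

Lemma measurable_fun_sub (D : set (measurableTypeR R)) : measurable D -> D `<=` `[0, L] ->
  measurable_fun D (fun u => (f u)%:E).
Proof. by move=> mD DL; apply/measurable_EFinP; exact: measurable_funS mf. Qed.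

Lemma integral_itv_split a b : 0 <= a -> a <= b -> b <= L ->
  (\int[mu]_(u in `[0%R, b]) (f u)%:E =
   \int[mu]_(u in `[0%R, a]) (f u)%:E + \int[mu]_(u in `]a, b]) (f u)%:E)%E.
Proof.
move=> a0 ab bL.
have E : `[0%R, b]%classic = `[0%R, a] `|` `]a, b].
  by rewrite (@itv_bndbnd_setU _ _ _ (BRight a)) ?bnd_simp.
rewrite E ge0_integral_setU//=.
- apply: measurable_fun_sub; first exact: measurableU.
  by move=> x /=; rewrite !in_itv/= => -[]/andP[ax xb]; apply/andP; split; lra.
- by move=> x /=; rewrite !in_itv/= => -[]/andP[ax xb]; rewrite lee_fin f0//;
    apply/andP; split; lra.
- apply/disj_setPS => x [] /=; rewrite !in_itv/= => /andP[_ xa] /andP[ax _].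
  by move: xa; rewrite leNgt ax.
Qed.

Lemma integral_itv_cst a b (M : R) : a <= b ->
  (\int[mu]_(u in `]a, b]) (cst M%:E u) = (M * (b - a))%:E)%E.
Proof.
move=> ab; rewrite integral_cst//= lebesgue_measure_itv/= lte_fin.
by move: ab; rewrite le_eqVlt => /predU1P[->|->];
  rewrite ?ltxx ?subrr ?mulr0 ?mule0.
Qed.

Lemma integral_itv_le a b M : 0 <= a -> a <= b -> b <= L ->
  (forall u, a < u <= b -> f u <= M) ->
  (\int[mu]_(u in `]a, b]) (f u)%:E <= (M * (b - a))%:E)%E.
Proof.
move=> a0 ab bL fM.
rewrite -integral_itv_cst//.
have sub u : a < u <= b -> 0 <= u <= L.
  by move=> /andP[au ub]; rewrite (le_trans a0 (ltW au)) (le_trans ub).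
apply: ge0_le_integral => //=.
- by move=> u; rewrite in_itv/= => /sub; rewrite lee_fin; exact: f0.
- by apply: measurable_fun_sub => // u; rewrite /= !in_itv/=; apply: sub.
Qed.

Lemma integral_itv_ge a b M : 0 <= a -> a <= b -> b <= L -> 0 <= M ->
  (forall u, a < u <= b -> M <= f u) ->
  ((M * (b - a))%:E <= \int[mu]_(u in `]a, b]) (f u)%:E)%E.
Proof.
move=> a0 ab bL M0 fM.
rewrite -integral_itv_cst//.
have sub u : a < u <= b -> 0 <= u <= L.
  by move=> /andP[au ub]; rewrite (le_trans a0 (ltW au)) (le_trans ub).
apply: ge0_le_integral => //=.
by apply: measurable_fun_sub => // u; rewrite /= !in_itv/=; apply: sub.
Qed.

End IntegralBounds.

(** * Greedy subdivision of a curve *)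

Lemma lipschitz_fun_continuous (R : realType) (X : normedModType R) (f : R -> X) (K : R) :
  (forall x y, `|f x - f y| <= K * `|x - y|) -> continuous f.
Proof.
move=> fK x; apply/cvgrPdist_lt => e e0.
have K1 : 0 < `|K| + 1 by rewrite ltr_wpDl.
apply/nbhs_ballP; exists (e / (`|K| + 1)) => /=; first exact: divr_gt0.
move=> y /= xy; apply: le_lt_trans (fK x y) _.
apply: (@le_lt_trans _ _ ((`|K| + 1) * `|x - y|)).
  by apply: ler_wpM2r => //; have := ler_norm K; lra.
by rewrite mulrC -ltr_pdivlMr.
Qed.

Section Clamp.
Context {R : realType}.
Implicit Types x y : R.

(** The projection onto [0, L]. *)
Definition clamp (L x : R) : R := Num.max 0 (Num.min x L).

Lemma clamp_lip L x y : 0 <= L -> `|clamp L x - clamp L y| <= `|x - y|.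
Proof.
move=> L0; wlog xy : x y / x <= y => [H|].
  by case: (leP x y) => [/H//|/ltW/H]; rewrite distrC (distrC y).
rewrite distrC (distrC x) [leRHS]ger0_norm ?subr_ge0//.
have H : clamp L x <= clamp L y /\ clamp L y - clamp L x <= y - x.
  rewrite /clamp; case: (leP x L) => xL; case: (leP y L) => yL;
    case: (leP 0 x) => ?; case: (leP 0 y) => ?; case: (leP 0 L) => ?; try split; lra.
by rewrite ger0_norm ?subr_ge0; case: H.
Qed.

Lemma clamp_mono L x y : 0 <= L -> x <= y -> clamp L x <= clamp L y.
Proof.
move=> L0 xy; rewrite /clamp; case: (leP x L) => xL; case: (leP y L) => yL;
  case: (leP 0 x) => ?; case: (leP 0 y) => ?; case: (leP 0 L) => ?; lra.
Qed.

Lemma clamp_id L x : 0 <= x <= L -> clamp L x = x.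
Proof. by move=> /andP[x0 xL]; rewrite /clamp min_l// max_r. Qed.

Lemma clamp_itv L x : 0 <= L -> 0 <= clamp L x <= L.
Proof. by move=> L0; rewrite /clamp le_max lexx/= ge_max L0 ge_min lexx orbT. Qed.

Lemma clamp_eqL L x : 0 <= L -> L <= x -> clamp L x = L.
Proof. by move=> L0 Lx; rewrite /clamp min_r// max_r. Qed.

Lemma clamp_eq0 L x : x <= 0 -> clamp L x = 0.
Proof. by move=> x0; rewrite /clamp max_l// ge_min x0. Qed.

(** The integrand is extended by constants outside [0, L], which makes it
    continuous on the whole line. *)
Lemma measurable_lipschitz_inv (L : R) (phi : R -> R) : 0 <= L ->
  (forall u, 0 <= u <= L -> 0 < phi u) ->
  (forall u v, 0 <= u -> u <= v -> v <= L -> `|phi v - phi u| <= v - u) ->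
  measurable_fun `[0%R, L] (fun u => (phi u)^-1).
Proof.
move=> L0 phi0 lip.
pose psi u := phi (clamp L u).
have cpsi : continuous psi.
  apply: (@lipschitz_fun_continuous _ _ psi 1) => x y; rewrite mul1r.
  wlog xy : x y / x <= y => [H|].
    by case: (leP x y) => [/H//|/ltW/H]; rewrite distrC (distrC y).
  rewrite distrC (distrC x); apply: le_trans (clamp_lip _ _ L0).
  have /andP[cx _] := clamp_itv x L0; have /andP[_ cy] := clamp_itv y L0.
  apply: le_trans (lip _ _ cx (clamp_mono L0 xy) cy) _; exact: ler_norm.
have cV : continuous (fun u => (psi u)^-1).
  move=> u; apply: cvgV; last exact: cpsi.
  by rewrite gt_eqF// phi0// clamp_itv.
apply: (@eq_measurable_fun _ _ _ _ _ (fun u => (psi u)^-1)).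
  by move=> u; rewrite inE/= in_itv/= => u0L; rewrite /psi clamp_id.
by apply: measurable_funTS; exact: continuous_measurable_fun.
Qed.

(** Going forward by c phi(u_i) from u_i, the function phi stays below
    (1 + c) phi(u_i), so each such step uses at least c / (1 + c) of the
    integral of 1 / phi.  The end point L is reached before n steps are
    completed. *)
Lemma greedy_subdivision (L c rho : R) (phi : R -> R) (n : nat) : 0 <= L ->
  (forall u, 0 <= u <= L -> 0 < phi u) ->
  (forall u v, 0 <= u -> u <= v -> v <= L -> `|phi v - phi u| <= v - u) ->
  0 < c ->
  (\int[lebesgue_measure]_(u in `[0%R, L]) ((phi u)^-1)%:E < rho%:E)%E ->
  rho <= n%:R * (c / (1 + c)) ->
  exists u : nat -> R, [/\ u 0%N = 0, u n = L &
    forall i, [/\ 0 <= u i, u i <= u i.+1, u i.+1 <= L & u i.+1 - u i <= c * phi (u i)]].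
Proof.
move=> L0 phi0 lip c0 Irho rhon.
pose f u := (phi u)^-1.
have mf : measurable_fun `[0%R, L] f by exact: measurable_lipschitz_inv.
have f0 u : 0 <= u <= L -> 0 <= f u by move=> /phi0; rewrite invr_ge0 => /ltW.
pose step v := Num.min L (v + c * phi v).
pose u i := iter i step 0.
have uL i : 0 <= u i <= L.
  elim: i => [|i /andP[ui0 uiL]]; first by rewrite lexx.
  rewrite /u iterS -/(u i) /step le_min L0 ge_min lexx/= andbT.
  by rewrite addr_ge0// mulr_ge0// ?ltW// phi0// ui0.
have uS i : u i <= u i.+1.
  rewrite [u i.+1]iterS -/(u i) /step le_min; have /andP[ui0 uiL] := uL i.
  by rewrite uiL lerDl mulr_ge0// ltW// phi0// ui0.
have ustep i : u i.+1 - u i <= c * phi (u i).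
  by rewrite [u i.+1]iterS -/(u i) /step lerBlDl ge_min lexx orbT.
exists u; split => //; last first.
  by move=> i; have /andP[ui0 _] := uL i; have /andP[_ uiL] := uL i.+1.
have key i : u i = L \/ ((i%:R * (c / (1 + c)))%:E <=
    \int[lebesgue_measure]_(v in `[0%R, u i]) (f v)%:E)%E.
  elim: i => [|i IH].
    right; rewrite mul0r; apply: integral_ge0 => v; rewrite /= in_itv/= => v0.
    rewrite lee_fin f0//; move: v0 => /andP[-> /le_trans->//].
  have /andP[ui0 uiL] := uL i.
  case: IH => [E|IH].
    left; rewrite [u i.+1]iterS -/(u i) E /step min_l// lerDl mulr_ge0// ltW//.
    by rewrite phi0// L0 lexx.
  have [Lu|uL'] := leP L (u i + c * phi (u i)).
    by left; rewrite [u i.+1]iterS -/(u i) /step min_l.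
  right; have E : u i.+1 = u i + c * phi (u i).
    by rewrite [LHS]iterS -/(u i) /step min_r// ltW.
  have p0 : 0 < phi (u i) by apply: phi0; exact: uL.
  have /andP[_ uSL] := uL i.+1.
  rewrite (integral_itv_split mf f0 ui0 (uS i) uSL).
  rewrite -natr1 mulrDl mul1r EFinD; apply: leeD => //.
  have c1 : 0 < 1 + c by lra.
  have M0 : 0 <= ((1 + c) * phi (u i))^-1.
    by rewrite invr_ge0 mulr_ge0// ltW.
  have -> : c / (1 + c) = ((1 + c) * phi (u i))^-1 * (u i.+1 - u i).
    by rewrite E [u i + _]addrC addrK; field; rewrite !gt_eqF.
  apply: (integral_itv_ge mf ui0 (uS i) uSL M0).
  move=> v /andP[uv vu]; have vL := le_trans vu uSL.
  have v0 := le_trans ui0 (ltW uv).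
  have pv : 0 < phi v by rewrite phi0// v0.
  rewrite /f lef_pV2 ?posrE ?mulr_gt0//.
  have := lip _ _ ui0 (ltW uv) vL; rewrite ler_norml => /andP[_].
  rewrite E in vu; lra.
case: (key n) => // H; exfalso.
have /andP[un0 unL] := uL n.
have : (rho%:E <= \int[lebesgue_measure]_(v in `[0%R, L]) (f v)%:E)%E.
  apply: le_trans (le_trans H _); first by rewrite lee_fin.
  rewrite (integral_itv_split mf f0 un0 unL (lexx L)) leeDl//.
  apply: integral_ge0 => v; rewrite /= in_itv/= => /andP[uv vL].
  by rewrite lee_fin f0// vL (le_trans un0 (ltW uv)).
by rewrite leNgt Irho.
Qed.

End Clamp.

(** * Curves and chains: two bounds on the quasihyperbolic distance *)

Section Chains.
Context {R : realType} {X : normedModType R} (Omega : set X).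
Hypotheses (oO : open Omega) (b0 : boundary Omega !=set0).
Local Notation d := (boundary_dist Omega).
Local Notation k := (quasihyperbolic Omega).
Implicit Types (p : nat -> X) (n : nat).

(** A curve can be followed in n relative steps of size c, as soon as
    n c / (1 + c) is at least its quasihyperbolic length. *)
Lemma quasihyperbolic_chain x y (rho c : R) n : (k x y < rho%:E)%E -> 0 < c ->
  rho <= n%:R * (c / (1 + c)) ->
  exists p, [/\ p 0%N = x, p n = y, forall i, Omega (p i) &
    forall i, `|p i.+1 - p i| <= c * d (p i)].
Proof.
move=> /ereal_inf_lt[_ [g [cg g0 g1 gO lg] <-]] Ig c0 rn.
have L0 := total_length_ge0 lg.
pose G := arclength_param g.
have GO u : 0 <= u <= total_length g -> Omega (G u).
  move=> /andP[_ uL]; apply: gO; exists (arclength_time g u) => //=.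
  by rewrite in_itv/=; exact: arclength_time_itv.
have lip u v : 0 <= u -> u <= v -> v <= total_length g -> `|G v - G u| <= v - u.
  by move=> *; exact: arclength_param_lip.
have [||u [u0 un Hu]] :=
    @greedy_subdivision _ (total_length g) c rho (fun u => d (G u)) n L0 _ _ c0 Ig rn.
- by move=> u /GO; exact: boundary_dist_gt0.
- move=> u v u0 uv vL; apply: le_trans (lip _ _ u0 uv vL).
  exact: boundary_dist_norm_lip.
exists (G \o u); split => /=.
- by rewrite u0 /G arclength_param0.
- by rewrite un /G arclength_paramL.
- move=> i; apply: GO; have [ui _ _ _] := Hu i; have [_ uuS uSL _] := Hu i.
  by rewrite ui (le_trans uuS).
- by move=> i; have [ui uuS uSL H] := Hu i; apply: le_trans (lip _ _ _ _ _) H.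
Qed.

Lemma nat_floor_le n (y : R) : 0 <= y <= n.+1%:R ->
  exists2 i, (i <= n)%N & i%:R <= y <= i.+1%:R.
Proof.
elim: n => [|n IH] /andP[y0 yn]; first by exists 0%N => //; rewrite y0.
have [yn'|/ltW yn'] := leP y n.+1%:R; last by exists n.+1 => //; rewrite yn'.
by have [|i ni H] := IH; rewrite ?y0// ; exists i => //; exact: leqW.
Qed.

(** With y = n t, the left-hand side describes the polygon through the F j as one
    formula in t: the terms before the current edge are complete, and those
    after it vanish. *)
Lemma sum_clamp (V : lmodType R) (F : nat -> V) n i (y : R) : (i < n)%N ->
  i%:R <= y <= i.+1%:R ->
  \sum_(0 <= j < n) clamp 1 (y - j%:R) *: (F j.+1 - F j) =
  F i - F 0%N + (y - i%:R) *: (F i.+1 - F i).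
Proof.
move=> ni /andP[iy yi].
rewrite (big_cat_nat (n := i))//= ?(ltnW ni)//; congr (_ + _).
  rewrite -telescope_sumr//; apply: eq_big_nat => j /andP[_ ji].
  rewrite clamp_eqL ?scale1r// lerBrDr addrC natr1.
  by apply: le_trans iy; rewrite ler_nat.
rewrite big_ltn// big_nat big1 ?addr0.
  rewrite clamp_id// subr_ge0 iy/= lerBlDr addrC natr1 //.
move=> j /andP[ij _]; rewrite clamp_eq0 ?scale0r// subr_le0.
by apply: le_trans yi _; rewrite ler_nat.
Qed.

(** On the edge from p_i the distance to the boundary is at least
    (1 - w_i) d(p_i), and the length of that edge is at most w_i d(p_i).  The
    integral is split at the arc lengths of the vertices, and between the
    vertices i and i + 1 the arc length grows by at most the length of the
    edge. *)
Lemma quasihyperbolic_le_chain p (w : nat -> R) n :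
  (forall i, (i <= n.+1)%N -> Omega (p i)) ->
  (forall i, (i <= n)%N -> `|p i.+1 - p i| <= w i * d (p i) /\ w i < 1) ->
  (k (p 0%N) (p n.+1) <= (\sum_(0 <= i < n.+1) w i / (1 - w i))%:E)%E.
Proof.
move=> pO pw.
pose N : R := n.+1%:R.
have N0 : 0 < N by rewrite /N ltr0n.
pose l i := `|p i.+1 - p i|.
pose S j := \sum_(0 <= i < j) l i.
pose G (t : R) := p 0%N + \sum_(0 <= j < n.+1) clamp 1 (N * t - j%:R) *: (p j.+1 - p j).
pose V (t : R) := \sum_(0 <= j < n.+1) clamp 1 (N * t - j%:R) * l j.
(* V is the arc length that the polygon G is expected to have *)
have GV x y : x <= y -> `|G y - G x| <= V y - V x.
  move=> xy; rewrite /G opprD addrACA subrr add0r -!sumrB.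
  apply: le_trans (ler_norm_sum _ _ _) _; apply: ler_sum => j _.
  rewrite -scalerBl normrZ -mulrBl ger0_norm// subr_ge0.
  by apply: clamp_mono => //; rewrite lerD2r ler_pM2l.
have VE i y : (i < n.+1)%N -> i%:R <= N * y <= i.+1%:R ->
    V y = S i + (N * y - i%:R) * l i.
  move=> ni iy; have := @sum_clamp R^o S n.+1 i (N * y) ni iy.
  have S0 : S 0%N = 0 by rewrite /S big_geq.
  rewrite S0 subr0.
  have El j : S j.+1 - S j = l j by rewrite /S big_nat_recr//= addrAC subrr add0r.
  rewrite El => <-; apply: eq_bigr => j _; by rewrite El.
have GE i y : (i < n.+1)%N -> i%:R <= N * y <= i.+1%:R ->
    G y = p i + (N * y - i%:R) *: (p i.+1 - p i).
  by move=> ni iy; rewrite /G (sum_clamp _ ni iy) addrA addrCA subrr addr0.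
have cG : continuous G.
  apply: (@lipschitz_fun_continuous _ _ _ (\sum_(0 <= j < n.+1) N * l j)) => x y.
  wlog xy : x y / x <= y => [H|].
    by case: (leP x y) => [/H//|/ltW/H]; rewrite distrC (distrC y).
  rewrite distrC (distrC x); apply: le_trans (GV _ _ xy) _.
  rewrite mulr_suml -sumrB; apply: ler_sum => j _; rewrite -mulrBl.
  rewrite mulrAC ler_wpM2r ?normr_ge0//.
  apply: le_trans (ler_norm _) _; apply: le_trans (clamp_lip _ _ ler01) _.
  by rewrite opprB addrA subrK -mulrBr normrM gtr0_norm.
pose t i : R := i%:R / N.
have Nt i : N * t i = i%:R by rewrite /t mulrCA divff ?mulr1// gt_eqF.
have t01 i : (i <= n.+1)%N -> 0 <= t i <= 1.
  move=> ni; rewrite /t divr_ge0 ?(ltW N0)//= ler_pdivrMr// mul1r /N ler_nat //.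
have tS i : t i <= t i.+1 by rewrite /t ler_pM2r ?invr_gt0// ler_nat.
have Vt i : (i <= n)%N -> V (t i.+1) - V (t i) = l i.
  move=> ni; rewrite !(VE i)// ?Nt ?lexx ?ler_nat ?leqnn ?leqnSn//.
  by rewrite -natr1; ring.
have seg y : 0 <= y <= 1 -> exists2 i, (i <= n)%N & i%:R <= N * y <= i.+1%:R.
  move=> /andP[y0 y1]; apply: nat_floor_le; rewrite mulr_ge0 ?(ltW N0)//=.
  by rewrite -[leRHS]mulr1 ler_pM2l.
have w0 i : (i <= n)%N -> 0 <= w i.
  move=> ni; have [H _] := pw _ ni; have := le_trans (normr_ge0 _) H.
  by rewrite pmulr_lge0// boundary_dist_gt0//; apply: pO; exact: leqW.
have edge i y : (i <= n)%N -> i%:R <= N * y <= i.+1%:R ->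
    Omega (G y) /\ d (p i) * (1 - w i) <= d (G y).
  move=> ni iy; have Opi : Omega (p i) by apply: pO; exact: leqW.
  have d0 := boundary_dist_gt0 oO b0 Opi.
  have [H wi1] := pw _ ni.
  have GH : `|p i - G y| <= w i * d (p i).
    rewrite (GE i)// distrC [p i + _]addrC addrK normrZ; apply: le_trans H.
    rewrite -[leRHS]mul1r ler_wpM2r// ger0_norm; move: iy; rewrite -natr1; lra.
  split.
    apply: (boundary_dist_ball oO Opi); apply: le_lt_trans GH _.
    by rewrite gtr_pMl.
  have := boundary_dist_lip (p i) (G y) b0; lra.
have s1V x y : 0 <= x -> x <= y ->
    (curve_length 0%R y G <= curve_length 0%R x G + (V y - V x)%:E)%E.
  by move=> x0 xy; apply: curve_length_majorant => // u v u0 uv _; exact: GV.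
have lG : (curve_length 0%R 1%R G < +oo)%E.
  apply: le_lt_trans (s1V _ _ (lexx _) ler01) _.
  by rewrite curve_length0 add0e ltry.
have cGw : {within `[0, 1], continuous G} by exact: continuous_subspaceT.
have G0 : G 0 = p 0%N.
  by rewrite (GE 0%N)// ?mulr0 ?subr0 ?scale0r ?addr0// lexx ler01.
have G1 : G 1 = p n.+1.
  rewrite (GE n)// ?mulr1; last by rewrite /N lexx ler_nat leqnSn.
  by rewrite /N -natr1 [_ + 1]addrC addrK scale1r addrC subrK.
apply: le_trans (ereal_inf_lbound _) _.
  exists G => //; split => // _ [y /= y01 <-]; rewrite in_itv/= in y01.
  by have [i ni /(edge _ _ ni)[]] := seg y y01.
rewrite /line_integral -/(total_length G).
pose L := total_length G; pose f u := (d (arclength_param G u))^-1.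
have L0 : 0 <= L := total_length_ge0 lG.
have fL u : 0 <= u <= L -> 0 < d (arclength_param G u).
  move=> /andP[_ uL]; apply: boundary_dist_gt0 => //.
  have /seg[i ni /(edge _ _ ni)[]// ] := arclength_time_itv lG uL.
have mf : measurable_fun `[0%R, L] f.
  apply: measurable_lipschitz_inv => // u v u0 uv vL.
  apply: le_trans (arclength_param_lip cGw lG u0 uv vL).
  exact: boundary_dist_norm_lip.
have f0 u : 0 <= u <= L -> 0 <= f u by move=> /fL; rewrite invr_ge0 => /ltW.
pose s i := fine (curve_length 0%R (t i) G).
have sE i : (i <= n.+1)%N -> curve_length 0%R (t i) G = (s i)%:E.
  move=> /t01/andP[ti0 ti1]; rewrite /s fineK// ge0_fin_numE ?curve_length_ge0//.
  apply: le_lt_trans lG; exact: curve_length_mono.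
have s0 i : (i <= n.+1)%N -> 0 <= s i.
  move=> ni; rewrite -lee_fin -sE// curve_length_ge0//.
  by case/andP: (t01 _ ni).
have sS i : (i <= n)%N -> s i <= s i.+1 <= s i + l i.
  move=> ni; have /andP[ti0 _] := t01 _ (leqW ni).
  rewrite -!lee_fin EFinD -!sE ?(leqW ni)// -(Vt _ ni) s1V// andbT.
  exact: curve_length_mono.
have sL i : (i <= n.+1)%N -> s i <= L.
  move=> ni; have /andP[ti0 ti1] := t01 _ ni.
  rewrite -lee_fin -sE// -total_lengthE//; exact: curve_length_mono.
have key i : (i <= n.+1)%N -> (\int[lebesgue_measure]_(u in `[0%R, s i]) (f u)%:E <=
    (\sum_(0 <= j < i) w j / (1 - w j))%:E)%E.
  elim: i => [_|i IH ni].
    rewrite big_geq// /s /t mul0r curve_length0/= set_itv1 integral_set1 //.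
  have /andP[sS1 sS2] := sS _ ni.
  rewrite (integral_itv_split mf f0 (s0 _ (ltnW ni)) sS1 (sL _ ni)).
  rewrite big_nat_recr//= EFinD; apply: leeD; first exact/IH/ltnW.
  have Opi : Omega (p i) by apply: pO; exact: leqW.
  have d0 := boundary_dist_gt0 oO b0 Opi.
  have [H wi1] := pw _ ni.
  apply: le_trans (integral_itv_le (M := (d (p i) * (1 - w i))^-1) mf f0
    (s0 _ (ltnW ni)) sS1 (sL _ ni) _) _.
    move=> u /andP[su us].
    have uL : u <= L by apply: le_trans us (sL _ ni).
    have u0 : 0 <= u by apply: le_trans (s0 _ (ltnW ni)) (ltW su).
    have Tu : i%:R <= N * arclength_time G u <= i.+1%:R.
      rewrite -!Nt !ler_pM2l//; apply/andP; split.
        apply: arclength_time_ge => //; first by case/andP: (t01 _ (leqW ni)).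
        by rewrite sE ?lte_fin// leqW.
      by apply: arclength_time_le; [exact: t01|rewrite sE// lee_fin].
    have [_ dG] := edge _ _ ni Tu.
    rewrite /f lef_pV2 ?posrE// ?fL ?u0// mulr_gt0// subr_gt0//.
  rewrite lee_fin invfM mulrAC ler_wpM2r ?invr_ge0 ?subr_ge0 ?(ltW wi1)//.
  rewrite mulrC ler_pdivrMr//; apply: le_trans H; rewrite -/(l i); lra.
have := key n.+1 (leqnn _); rewrite (_ : s n.+1 = L)//.
by apply/EFin_inj; rewrite -sE// -total_lengthE// /t divff ?gt_eqF.
Qed.

End Chains.

(** * Minkowski functionals *)

Section Minkowski.
Context {R : realType} {X : normedModType R} (B : set X) (a b : R).
Hypotheses (a0 : 0 < a) (b0 : 0 < b).
Hypothesis Ba : forall x, `|x| <= a -> B x.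
Hypothesis Bb : forall x, B x -> `|x| <= b.
Hypothesis cB : forall x y (t : R), 0 <= t <= 1 -> B x -> B y -> B (t *: x + (1 - t) *: y).
Hypothesis sB : forall x, B x -> B (- x).
Local Notation M := (minkowski_functional B).

Let B0 : B 0. Proof. by apply: Ba; rewrite normr0 ltW. Qed.

Lemma minkowski_le x (l : R) : 0 < l -> B (l^-1 *: x) -> M x <= l.
Proof.
move=> l0 Bx; apply: ge_inf; first by exists 0 => t [/ltW].
by split => //; exists (l^-1 *: x) => //; rewrite scalerA divff ?scale1r// gt_eqF.
Qed.

Lemma minkowski_set_nonempty x :
  [set l : R | 0 < l /\ [set l *: b | b in B] x] !=set0.
Proof.
have l0 : 0 < `|x| / a + 1 by rewrite ltr_wpDl// divr_ge0// ltW.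
exists (`|x| / a + 1); split => //.
exists ((`|x| / a + 1)^-1 *: x); last by rewrite scalerA divff ?scale1r// gt_eqF.
apply: Ba; rewrite normrZ gtr0_norm ?invr_gt0// ler_pdivrMl// mulrDl mul1r divfK ?gt_eqF//.
by rewrite lerDl ltW.
Qed.

(** B is star-shaped with respect to 0, hence the dilations of B increase. *)
Lemma minkowski_lt x (l : R) : M x < l -> 0 < l /\ B (l^-1 *: x).
Proof.
move=> /(inf_lt (minkowski_set_nonempty x))[t [t0 [y By <-]] tl].
have l0 := lt_trans t0 tl; split => //; rewrite scalerA.
have := @cB y 0 (l^-1 * t); rewrite scaler0 addr0; apply => //.
by rewrite mulr_ge0 ?invr_ge0 ?(ltW l0) ?(ltW t0)//= ler_pdivrMl// mulr1 ltW.
Qed.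

Lemma minkowski_ge x (l : R) : (forall t, 0 < t -> B (t^-1 *: x) -> l <= t) -> l <= M x.
Proof.
move=> H; apply: lb_le_inf (minkowski_set_nonempty x) _ => t [t0 [y By yx]].
by apply: H => //; rewrite -yx scalerA mulVf ?scale1r// gt_eqF.
Qed.

Lemma minkowski_ge_norm x : `|x| / b <= M x.
Proof.
apply: minkowski_ge => t t0 /Bb; rewrite normrZ gtr0_norm ?invr_gt0//.
by rewrite ler_pdivrMl// ler_pdivrMr// mulrC.
Qed.

Lemma minkowski_le_norm x : M x <= `|x| / a.
Proof.
apply/ler_addgt0Pr => e e0.
have xa : 0 <= `|x| / a by rewrite divr_ge0// ltW.
have l0 : 0 < `|x| / a + e by lra.
apply: minkowski_le => //; apply: Ba.
rewrite normrZ gtr0_norm ?invr_gt0// ler_pdivrMl// mulrDl divfK ?gt_eqF//.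
by rewrite lerDl mulr_ge0// ltW.
Qed.

Lemma minkowski_ge0 x : 0 <= M x.
Proof. by apply: le_trans (minkowski_ge_norm x); rewrite divr_ge0// ltW. Qed.

Lemma minkowski_triangle x y : M (x + y) <= M x + M y.
Proof.
apply/ler_addgt0Pr => e e0.
have [s0 Bx] := @minkowski_lt x (M x + e / 2) ltac:(lra).
have [t0 By] := @minkowski_lt y (M y + e / 2) ltac:(lra).
set s := M x + _ in s0 Bx; set t := M y + _ in t0 By.
have -> : M x + M y + e = s + t by rewrite /s /t; field.
have st0 : 0 < s + t by exact: addr_gt0.
apply: minkowski_le => //.
have st : 0 <= s / (s + t) <= 1.
  by rewrite divr_ge0 ?(ltW s0) ?(ltW st0)//= ler_pdivrMr// mul1r; lra.
have := cB st Bx By; rewrite !scalerA scalerDr; congr (B (_ *: _ + _ *: _)).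
  by field; rewrite !gt_eqF.
by field; rewrite !gt_eqF.
Qed.

Let minkowski_scale_le (l : R) x : 0 < l -> M (l *: x) <= l * M x.
Proof.
move=> l0; rewrite -ler_pdivrMl//; apply: minkowski_ge => t t0 Bt.
rewrite ler_pdivrMl//; apply: minkowski_le; first exact: mulr_gt0.
by rewrite scalerA invfM mulrAC mulVf ?mul1r// gt_eqF.
Qed.

Lemma minkowski_scale (l : R) x : M (l *: x) = `|l| * M x.
Proof.
have pos t y : 0 < t -> M (t *: y) = t * M y.
  move=> t0; apply/eqP; rewrite eq_le minkowski_scale_le//=.
  rewrite -ler_pdivlMl//; apply: le_trans (minkowski_scale_le _ _); rewrite ?invr_gt0//.
  by rewrite scalerA mulVf ?scale1r// gt_eqF.
have opp_le y : M (- y) <= M y.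
  by apply: minkowski_ge => t t0 /sB By; apply: minkowski_le => //; rewrite scalerN.
have opp y : M (- y) = M y.
  by apply/eqP; rewrite eq_le opp_le -{1}(opprK y) opp_le.
have [l0|l0|->] := ltgtP l 0.
- by rewrite -[l]opprK scaleNr opp pos ?oppr_gt0// normrN gtr0_norm ?oppr_gt0.
- by rewrite pos// gtr0_norm.
- rewrite scale0r normr0 mul0r; apply/eqP; rewrite eq_le minkowski_ge0 andbT.
  by apply: le_trans (minkowski_le_norm 0) _; rewrite normr0 mul0r.
Qed.

Lemma minkowski_equivalent_norm : equivalent_norm M.
Proof.
split; first split.
- exact: minkowski_triangle.
- exact: minkowski_scale.
- move=> x Mx; have := minkowski_ge_norm x; rewrite Mx pmulr_lle0 ?invr_gt0//.
  by rewrite normr_le0 => /eqP.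
exists b^-1, a^-1; split; rewrite ?invr_gt0// => x.
by rewrite mulrC minkowski_ge_norm mulrC minkowski_le_norm.
Qed.

(** For x and y of norm 1, the points x / (1 + e) and y / (1 + e) lie in B, and
    e can be taken arbitrarily small. *)
Lemma minkowski_uniformly_convex :
  (forall eps : R, 0 < eps -> exists2 delta : R, 0 < delta &
     forall x y, B x -> B y -> eps <= `|x - y| ->
       B ((1 + delta) *: (2^-1 *: (x + y)))) ->
  uniformly_convex M.
Proof.
move=> H eps e0.
have ea0 : 0 < eps * a / 2 by rewrite divr_gt0// mulr_gt0.
have [delta d0 Hd] := H _ ea0.
have d1 : 0 < 1 + delta by lra.
exists (delta / (1 + delta)); first exact: divr_gt0.
move=> x y Mx My Mxy.
have -> : 1 - delta / (1 + delta) = (1 + delta)^-1 by field; rewrite gt_eqF.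
have nxy : eps * a <= `|x - y|.
  by rewrite -ler_pdivlMr//; apply: le_trans Mxy (minkowski_le_norm _).
apply/ler_addgt0Pr => e'' e''0.
pose e := Num.min 1 (e'' * (1 + delta)).
have e1 : e <= 1 by rewrite ge_min lexx.
have e2 : e <= e'' * (1 + delta) by rewrite ge_min lexx orbT.
have e'0 : 0 < e by rewrite lt_min ltr01 mulr_gt0.
have [l0 Bx] := @minkowski_lt x (1 + e) ltac:(lra).
have [_ By] := @minkowski_lt y (1 + e) ltac:(lra).
apply: le_trans (_ : (1 + e) / (1 + delta) <= _); last first.
  rewrite ler_pdivrMr// mulrDl mulVf ?gt_eqF//; lra.
apply: minkowski_le; first exact: divr_gt0.
have := Hd _ _ Bx By; rewrite -scalerBr normrZ gtr0_norm ?invr_gt0// -scalerDr.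
rewrite !scalerA invf_div => HH.
rewrite (_ : (1 + delta) / (1 + e) / 2 = (1 + delta) / 2 / (1 + e)); last first.
  by field; rewrite gt_eqF.
apply: HH; rewrite ler_pdivlMl//.
apply: le_trans nxy; rewrite mulrCA ger_pMr ?mulr_gt0//; lra.
Qed.

End Minkowski.

(** * Averaging chains *)

Section UnitBall.
Context {R : realType} {X : normedModType R}.
Hypothesis hX : uniformly_convex (fun x : X => `|x|).

(** Vectors of the unit ball whose sum has norm close to 2 have norm close to 1,
    so normalizing them changes them little. *)
Lemma uniformly_convex_ball (eps : R) : 0 < eps -> exists2 delta : R, 0 < delta <= 1 &
  forall x y : X, `|x| <= 1 -> `|y| <= 1 -> eps <= `|x - y| ->
    `|x + y| <= 2 * (1 - delta).
Proof.
move=> e0; have [d1 d10 H1] := hX (divr_gt0 e0 (ltr0n R 2)).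
pose d := Num.min (4^-1) (Num.min (eps / 8) (d1 / 4)).
have [da db dc] : [/\ d <= 4^-1, d <= eps / 8 & d <= d1 / 4].
  by rewrite /d; split; rewrite !ge_min lexx ?orbT.
have d0 : 0 < d by rewrite !lt_min; apply/and3P; split; lra.
exists d; first by rewrite d0/=; lra.
move=> x y x1 y1 xy; rewrite leNgt; apply/negP => Hxy.
have := ler_normD x y => T.
have unit (z : X) : 1 - 2 * d < `|z| -> `|z| <= 1 ->
    `| `|z|^-1 *: z| = 1 /\ `| `|z|^-1 *: z - z| <= 2 * d.
  move=> zd z1; have z0 : 0 < `|z| by lra.
  have zN : `|z| != 0 by rewrite gt_eqF.
  split; first by rewrite normrZ gtr0_norm ?invr_gt0// mulVf.
  have zV : 1 <= `|z|^-1 by rewrite -[leLHS]invr1 lef_pV2 ?posrE.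
  rewrite -{3}[z]scale1r -scalerBl normrZ ger0_norm ?subr_ge0// mulrBl mulVf//; lra.
have [x1' xx] := unit x ltac:(lra) x1.
have [y1' yy] := unit y ltac:(lra) y1.
set u := `|x|^-1 *: x in x1' xx; set v := `|y|^-1 *: y in y1' yy.
have uv : eps / 2 <= `|u - v|.
  have := ler_distD u x y; have := ler_distD v u y.
  by rewrite (distrC x u); lra.
have := H1 u v x1' y1' uv; rewrite normrZ gtr0_norm ?invr_gt0// => Huv.
have := ler_distD u x (- y); have := ler_distD (- v) u (- y).
by rewrite !opprK (distrC x u) [- v + y]addrC (distrC y v); lra.
Qed.


(** Steps a and b of two chains at points with boundary distances al and be.
    Either the rescaled steps a / (c al) and b / (c be) are kappa-close, and a - b
    is small (s = 0), or the sum a + b is shorter than the triangle inequality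
    says (s = 1).  The number s links the two estimates, which makes it possible
    to sum them over a chain. *)
Lemma uniformly_convex_step (kappa : R) : 0 < kappa -> exists2 delta : R, 0 < delta <= 1 &
  forall (c al be : R) (a b : X), 0 < c -> 0 < al -> 0 < be ->
    `|a| <= c * al -> `|b| <= c * be ->
    exists s : R, [/\ 0 <= s <= 1,
      `|a - b| <= c * `|al - be| + c * Num.min al be * (kappa + 2 * s) &
      `|a + b| <= c * (al + be) - 2 * delta * c * Num.min al be * s].
Proof.
move=> k0; have [d d01 H] := uniformly_convex_ball k0; exists d => // c al be a b c0.
wlog ab : al be a b / al <= be => [W|] al0 be0 aal bbe.
  have [/W|/W] := orP (le_total al be); first by apply.
  move=> /(_ b a be0 al0 bbe aal) [s [s01 H1 H2]]; exists s; split => //.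
  by rewrite distrC (distrC al) minC.
  by rewrite addrC [al + be]addrC minC.
rewrite min_l// ler0_norm ?subr_le0// opprB.
have ca : 0 < c * al by exact: mulr_gt0.
have cb : 0 < c * be by exact: mulr_gt0.
pose a' := (c * al)^-1 *: a; pose b' := (c * be)^-1 *: b.
have aE : a = (c * al) *: a' by rewrite /a' scalerA divff ?scale1r// gt_eqF.
(* the longer step is cut to the scale of the shorter one, which costs
   be - al in both estimates *)
have bE : b = (c * al) *: b' + (c * (be - al)) *: b'.
  rewrite -scalerDl -mulrDr [al + _]addrC subrK /b' scalerA divff ?scale1r// gt_eqF//.
have a1 : `|a'| <= 1.
  by rewrite normrZ gtr0_norm ?invr_gt0// mulrC ler_pdivrMr// mul1r.
have b1 : `|b'| <= 1.
  by rewrite normrZ gtr0_norm ?invr_gt0// mulrC ler_pdivrMr// mul1r.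
have rest : `|(c * (be - al)) *: b'| <= c * (be - al).
  by rewrite normrZ ger0_norm ?ler_piMr// mulr_ge0 ?subr_ge0// ltW.
have Eab : `|a - b| <= c * (be - al) + c * al * `|a' - b'|.
  rewrite aE bE opprD addrA -scalerBr.
  apply: le_trans (ler_normB _ _) _; rewrite addrC lerD//.
  by rewrite normrZ gtr0_norm.
have Eab' : `|a + b| <= c * (be - al) + c * al * `|a' + b'|.
  rewrite aE bE addrA -scalerDr.
  apply: le_trans (ler_normD _ _) _; rewrite addrC lerD//.
  by rewrite normrZ gtr0_norm.
have [far|near] := leP kappa `|a' - b'|.
  exists 1; split; first by rewrite ler01 lexx.
    apply: le_trans Eab _; rewrite lerD2l ler_pM2l// mulr1.
    have := ler_normB a' b'; lra.
  apply: le_trans Eab' _; have := H _ _ a1 b1 far.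
  by rewrite -(ler_pM2l ca); lra.
exists 0; split; first by rewrite lexx ler01.
  by apply: le_trans Eab _; rewrite lerD2l ler_pM2l// mulr0 addr0 ltW.
apply: le_trans Eab' _; rewrite mulr0 subr0.
have : `|a' + b'| <= 2 by have := ler_normD a' b'; lra.
by rewrite -(ler_pM2l ca); lra.
Qed.

End UnitBall.

Section ChainEstimates.
Context {R : realType} {X : normedModType R} (Omega : set X).
Hypotheses (oO : open Omega) (b0 : boundary Omega !=set0).
Local Notation d := (boundary_dist Omega).
Implicit Types (p q : nat -> X) (n i : nat) (c : R).

Definition fine_chain c p :=
  (forall i, Omega (p i)) /\ (forall i, `|p i.+1 - p i| <= c * d (p i)).

Lemma fine_chain_opp c p : symmetric_set Omega -> fine_chain c p ->
  fine_chain c (fun i => - p i).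
Proof.
move=> sO [pO pc]; split=> i; first by rewrite -sO; exists (p i).
by rewrite -opprD normrN boundary_dist_opp.
Qed.

(** Concavity of the distance to the boundary is what makes averages of chains
    into chains; this is the discrete form of the convexity of the balls. *)
Lemma fine_chain_conv c p q (t : R) : has_segments Omega -> 0 <= t <= 1 -> 0 <= c ->
  fine_chain c p -> fine_chain c q ->
  fine_chain c (fun i => t *: p i + (1 - t) *: q i).
Proof.
move=> cO t01 c0 [pO pc] [qO qc]; split=> i; first exact: cO.
have /andP[t0 t1] := t01.
have := boundary_dist_concave oO cO b0 (pO i) (qO i) t01 => /(ler_wpM2l c0).
apply: le_trans; rewrite opprD addrACA -!scalerBr.
apply: le_trans (ler_normD _ _) _; rewrite !normrZ !ger0_norm ?subr_ge0// mulrDr.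
by rewrite !(mulrCA c); apply: lerD; apply: ler_wpM2l; rewrite ?subr_ge0.
Qed.

Lemma fine_chain_midpoint c p q : has_segments Omega -> 0 <= c ->
  fine_chain c p -> fine_chain c q ->
  fine_chain c (fun i => 2^-1 *: (p i + q i)).
Proof.
move=> cO c0 fp fq; have h01 : 0 <= (2^-1 : R) <= 1 by lra.
have [mO mc] := fine_chain_conv cO h01 c0 fp fq.
by split=> i; have := mO i; have := mc i; rewrite !midpoint_conv.
Qed.

Lemma fine_chain_dist_le c p A n i : 0 <= c -> n%:R * c <= A -> (i <= n)%N ->
  fine_chain c p -> d (p i) <= expR A * d (p 0%N).
Proof.
move=> c0 nA ni [pO pc].
have d0 : 0 < d (p 0%N) by exact: boundary_dist_gt0.
have H j : d (p j) <= (expR c) ^+ j * d (p 0%N).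
  elim: j => [|j IH]; first by rewrite expr0 mul1r.
  rewrite exprS -mulrA; apply: le_trans (_ : (1 + c) * d (p j) <= _).
    by have := boundary_dist_lip (p j.+1) (p j) b0; have := pc j; lra.
  apply: ler_pM => //; [lra| |exact: expR_ge1Dx].
  by apply/ltW/boundary_dist_gt0.
apply: le_trans (H i) _; rewrite ler_pM2r// -expRM_natl ler_expR.
by apply: le_trans nA; apply: ler_wpM2r; rewrite ?ler_nat.
Qed.

Lemma fine_chain_dist_ge c p A n i : 0 <= c <= 2^-1 -> n%:R * c <= A -> (i <= n)%N ->
  fine_chain c p -> expR (- (2 * A)) * d (p 0%N) <= d (p i).
Proof.
move=> /andP[c0 c1] nA ni [pO pc].
have d0 : 0 < d (p 0%N) by exact: boundary_dist_gt0.
have H j : d (p 0%N) <= (expR (2 * c)) ^+ j * d (p j).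
  elim: j => [|j IH]; first by rewrite expr0 mul1r.
  apply: le_trans IH _; rewrite exprSr -mulrA ler_pM2l ?exprn_gt0 ?expR_gt0//.
  have dj : 0 < d (p j) by exact: boundary_dist_gt0.
  apply: le_trans (_ : (1 + 2 * c) * ((1 - c) * d (p j)) <= _).
    by rewrite mulrA ler_peMl ?(ltW dj)//; nra.
  apply: ler_pM => //; [lra|by apply: mulr_ge0; [lra|exact: ltW]|exact: expR_ge1Dx|].
  by have := boundary_dist_lip (p j) (p j.+1) b0; rewrite distrC; have := pc j; lra.
rewrite expRN ler_pdivrMl ?expR_gt0//; apply: le_trans (H i) _.
rewrite ler_pM2r ?boundary_dist_gt0// -expRM_natl ler_expR mulrCA ler_pM2l//.
by apply: le_trans nA; apply: ler_wpM2r; rewrite ?ler_nat.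
Qed.

Lemma fine_chain_norm c p A n : 0 <= c -> n%:R * c <= A -> fine_chain c p ->
  `|p n - p 0%N| <= A * (expR A * d (p 0%N)).
Proof.
move=> c0 nA fp; set D := expR A * _.
have D0 : 0 <= D by rewrite mulr_ge0 ?expR_ge0// ltW// boundary_dist_gt0//; case: fp.
have H j : (j <= n)%N -> `|p j - p 0%N| <= j%:R * c * D.
  elim: j => [_|j IH jn]; first by rewrite subrr normr0 !mul0r.
  have := ler_distD (p j) (p j.+1) (p 0%N); have := IH (ltnW jn).
  have := fine_chain_dist_le c0 nA (ltnW jn) fp => /(ler_wpM2l c0).
  by have := fp.2 j; rewrite -/D -natr1; lra.
by apply: le_trans (H n (leqnn n)) _; apply: ler_wpM2r.
Qed.

End ChainEstimates.

(** * The gain of a midpoint chain *)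

Section MidpointGain.
Context {R : realType} {X : normedModType R} (Omega : set X).
Hypothesis hX : uniformly_convex (fun x : X => `|x|).
Hypotheses (oO : open Omega) (b0 : boundary Omega !=set0).
Hypothesis cO : has_segments Omega.
Hypothesis O0 : Omega 0.
Local Notation d := (boundary_dist Omega).
Implicit Types (p q : nat -> X) (n i : nat) (c : R).

(** The relative steps w of the midpoint chain add up to at most n c - eta, where eta
    depends on the bound A of n c but neither on n nor on c: a chain of many
    small steps gains as much as one of few large steps. *)
Lemma midpoint_chain_gain (A eps : R) : 0 < A -> 0 < eps ->
  exists2 eta : R, 0 < eta & forall n c p q, 0 < c <= 2^-1 -> n%:R * c <= A ->
    fine_chain Omega c p -> fine_chain Omega c q -> p 0%N = 0 -> q 0%N = 0 ->
    eps <= `|p n - q n| ->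
    exists w : nat -> R,
      (forall i, (i < n)%N ->
        `|2^-1 *: (p i.+1 + q i.+1) - 2^-1 *: (p i + q i)|
          <= w i * d (2^-1 *: (p i + q i)) /\ 0 <= w i <= c) /\
      \sum_(0 <= i < n) w i <= n%:R * c - eta.
Proof.
move=> A0 e0; have d0 := boundary_dist_gt0 oO b0 O0.
pose D := expR A * d 0; pose dm := expR (- (2 * A)) * d 0.
have D0 : 0 < D by rewrite mulr_gt0 ?expR_gt0.
have dm0 : 0 < dm by rewrite mulr_gt0 ?expR_gt0.
have eA0 : 0 < expR A by rewrite expR_gt0.
have dmD : dm <= D by rewrite ler_pM2r// ler_expR; lra.
(* with this threshold, steps whose rescaled directions are kappa-close account
   for at most eps / 2 of the final distance *)
pose kappa := eps / (2 * expR A * D * A).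
have k0 : 0 < kappa by rewrite divr_gt0// !mulr_gt0.
have [delta /andP[delta0 delta1] step] := uniformly_convex_step hX k0.
pose delta' := delta * (dm / D).
have delta'0 : 0 < delta' by rewrite mulr_gt0// divr_gt0.
have delta'1 : delta' <= 1.
  apply: mulr_ile1; rewrite ?(ltW delta0)//; first by rewrite divr_ge0// ltW.
  by rewrite ler_pdivrMr// mul1r.
exists (delta' * (eps / (4 * expR A * D))).
  by rewrite mulr_gt0// divr_gt0// !mulr_gt0.
move=> n c p q /andP[c0 c2] nA fp fq p0 q0 epq.
have c0' := ltW c0.
pose m i := 2^-1 *: (p i + q i).
have fm : fine_chain Omega c m by exact: fine_chain_midpoint.
have /choice[s Hs] : forall i, exists si : R, [/\ 0 <= si <= 1,
   `|(p i.+1 - p i) - (q i.+1 - q i)| <= c * `|d (p i) - d (q i)| +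
       c * Num.min (d (p i)) (d (q i)) * (kappa + 2 * si) &
   `|(p i.+1 - p i) + (q i.+1 - q i)| <= c * (d (p i) + d (q i)) -
        2 * delta * c * Num.min (d (p i)) (d (q i)) * si].
  move=> i; apply: step c0 _ _ (fp.2 i) (fq.2 i).
    exact: boundary_dist_gt0 oO b0 (fp.1 i).
  exact: boundary_dist_gt0 oO b0 (fq.1 i).
have pD i : (i <= n)%N -> d (p i) <= D.
  by move=> ni; rewrite /D -p0; exact: (fine_chain_dist_le oO b0 c0' nA ni fp).
have mD i : (i <= n)%N -> d (m i) <= D.
  move=> ni; have -> : D = expR A * d (m 0%N) by rewrite /m p0 q0 addr0 scaler0.
  exact: (fine_chain_dist_le oO b0 c0' nA ni fm).
have c02 : 0 <= c <= 2^-1 by rewrite c0'.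
have pm i : (i <= n)%N -> dm <= d (p i).
  by move=> ni; rewrite /dm -p0; exact: (fine_chain_dist_ge oO b0 c02 nA ni fp).
have qm i : (i <= n)%N -> dm <= d (q i).
  by move=> ni; rewrite /dm -q0; exact: (fine_chain_dist_ge oO b0 c02 nA ni fq).
exists (fun i => c * (1 - delta' * s i)); split.
  move=> i ni; have [/andP[s0 s1] _ H] := Hs i.
  have ds : 0 <= delta' * s i <= 1 by rewrite mulr_ge0 ?(ltW delta'0)//= mulr_ile1// ltW.
  split; last by rewrite mulr_ge0//= ?ler_piMr//; lra.
  rewrite -scalerBr opprD addrACA normrZ gtr0_norm ?invr_gt0//.
  have h01 : 0 <= (2^-1 : R) <= 1 by lra.
  have := boundary_dist_concave oO cO b0 (fp.1 i) (fq.1 i) h01.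
  rewrite (midpoint_conv (p i)) -/(m i) => Hm.
  have Hmin : dm <= Num.min (d (p i)) (d (q i)) by rewrite le_min pm ?qm// ltnW.
  set mn := Num.min _ _ in H Hmin.
  have K : delta' * d (m i) <= delta * mn.
    rewrite /delta' -mulrA ler_pM2l// mulrAC ler_pdivrMr//.
    apply: ler_pM => //; [exact: ltW| |exact: mD (ltnW ni)].
    by apply/ltW/boundary_dist_gt0 => //; exact: fm.1.
  have K1 : c * s i * (delta' * d (m i)) <= c * s i * (delta * mn).
    by apply: ler_wpM2l => //; rewrite mulr_ge0.
  have K2 : c * (2^-1 * d (p i) + (1 - 2^-1) * d (q i)) <= c * d (m i).
    by rewrite ler_pM2l.
  lra.
(* discrete Gronwall inequality: the distance between the chains grows by a
   factor 1 + c per step, apart from the contribution of the directions *)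
have gron j : (j <= n)%N -> `|p j - q j| <= (1 + c) ^+ j *
     (c * D * (j%:R * kappa + 2 * \sum_(0 <= i < j) s i)).
  elim: j => [_|j IH jn]; first by rewrite p0 q0 subrr normr0 big_geq// !(mul0r,mulr0,addr0).
  have {}IH := IH (ltnW jn).
  have [/andP[s0 s1] H _] := Hs j.
  have S0 : 0 <= \sum_(0 <= i < j) s i by apply: sumr_ge0 => i _; have [/andP[]] := Hs i.
  have g1 : `|p j.+1 - q j.+1| <= `|p j - q j| + `|(p j.+1 - p j) - (q j.+1 - q j)|.
    have -> : p j.+1 - q j.+1 = (p j - q j) + ((p j.+1 - p j) - (q j.+1 - q j)).
      by rewrite addrACA -!opprD !(addrC _ (_ - _)) !subrK.
    exact: ler_normD.
  have g2 : `|d (p j) - d (q j)| <= `|p j - q j|.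
    rewrite ler_norml; have := boundary_dist_lip (p j) (q j) b0.
    have := boundary_dist_lip (q j) (p j) b0; rewrite (distrC (q j)); lra.
  have g3 : Num.min (d (p j)) (d (q j)) <= D by rewrite ge_min pD// ltnW.
  have s20 : 0 <= kappa + 2 * s j by have := ltW k0; lra.
  have g4 : c * Num.min (d (p j)) (d (q j)) * (kappa + 2 * s j) <= c * D * (kappa + 2 * s j).
    by apply: ler_wpM2r => //; rewrite ler_pM2l.
  have g5 : c * `|d (p j) - d (q j)| <= c * `|p j - q j| by rewrite ler_pM2l.
  have g6 : (1 + c) * `|p j - q j| <= (1 + c) * ((1 + c) ^+ j *
     (c * D * (j%:R * kappa + 2 * \sum_(0 <= i < j) s i))) by rewrite ler_pM2l//; lra.
  have g7 : c * D * (kappa + 2 * s j) <= (1 + c) ^+ j.+1 * (c * D * (kappa + 2 * s j)).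
    rewrite ler_peMl//; first by rewrite !mulr_ge0// ltW.
    by apply: exprn_ege1; lra.
  rewrite big_nat_recr//= -natr1 [in leRHS]mulrDl [in leRHS]mul1r.
  have -> : (1 + c) ^+ j.+1 *
      (c * D * (j%:R * kappa + kappa + 2 * (\sum_(0 <= i < j) s i + s j)))
    = (1 + c) * ((1 + c) ^+ j * (c * D * (j%:R * kappa + 2 * \sum_(0 <= i < j) s i)))
      + (1 + c) ^+ j.+1 * (c * D * (kappa + 2 * s j)) by rewrite exprS; ring.
  lra.
have S0 : 0 <= \sum_(0 <= i < n) s i by apply: sumr_ge0 => i _; have [/andP[]] := Hs i.
have cnA : (1 + c) ^+ n <= expR A.
  apply: le_trans (_ : expR c ^+ n <= _).
    by apply: lerXn2r; rewrite ?nnegrE ?expR_ge0//; [lra|exact: expR_ge1Dx].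
  by rewrite -expRM_natl ler_expR.
have main : eps <= expR A * D * (A * kappa + 2 * (c * \sum_(0 <= i < n) s i)).
  apply: le_trans epq (le_trans (gron n (leqnn n)) _).
  rewrite -[leRHS]mulrA; apply: ler_pM => //.
  - by rewrite exprn_ge0//; lra.
  - apply: mulr_ge0; first by rewrite mulr_ge0// ltW.
    by rewrite addr_ge0// mulr_ge0// ltW.
  rewrite [c * D]mulrC -mulrA ler_pM2l// mulrDr [c * (2 * _)]mulrCA lerD2r.
  by rewrite mulrA [c * _]mulrC ler_pM2r.
have E1 : expR A * D * (A * kappa) = eps / 2.
  by rewrite /kappa; field; rewrite !gt_eqF.
have gain : eps / (4 * expR A * D) <= c * \sum_(0 <= i < n) s i.
  by rewrite ler_pdivrMr ?mulr_gt0//; lra.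
have -> : \sum_(0 <= i < n) c * (1 - delta' * s i) =
    n%:R * c - delta' * (c * \sum_(0 <= i < n) s i).
  rewrite -mulr_sumr sumrB -mulr_sumr big_const_nat subn0 iter_addr_0 mulrBr.
  by rewrite mulrCA mulrC.
by rewrite lerD2l lerN2 ler_pM2l.
Qed.

End MidpointGain.

(** * Convexity of quasihyperbolic balls *)

(** Any radius rho > r close to r does, with c = rho / (n - rho), for which
    n c / (1 + c) = rho and n c / (1 - c) = rho + 2 rho^2 / (n - 2 rho). *)
Lemma fine_parameters (R : realType) (r e : R) : 0 < r -> 0 < e <= 1 ->
  exists n (c rho : R), [/\ (0 < n)%N, r < rho & 0 < c <= 2^-1] /\
    [/\ rho <= n%:R * (c / (1 + c)), n%:R * c <= 2 * (r + 1) &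
        n%:R * c / (1 - c) <= r + e].
Proof.
move=> r0 /andP[e0 e1]; pose rho := r + e / 2.
have rho0 : 0 < rho by rewrite /rho; lra.
pose b := 3 * rho + 4 * rho ^+ 2 / e.
have f0 : 0 < 4 * rho ^+ 2 / e by rewrite divr_gt0// mulr_gt0// exprn_gt0.
have b0 : 0 < b by rewrite /b; lra.
have bn := archi_boundP (ltW b0); set n := Num.bound b in bn.
have n3 : 3 * rho < n%:R by apply: lt_trans bn; rewrite /b; lra.
have nr : 0 < n%:R - rho by lra.
exists n, (rho / (n%:R - rho)), rho; split.
  split; first by rewrite -(ltr_nat R); lra.
    by rewrite /rho; lra.
  rewrite divr_gt0//= ler_pdivrMr//; lra.
split.
- rewrite le_eqVlt; apply/orP; left; apply/eqP; field.
  by rewrite !gt_eqF//; lra.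
- by rewrite mulrA ler_pdivrMr// /rho in rho0 n3 *; nra.
- have -> : n%:R * (rho / (n%:R - rho)) / (1 - rho / (n%:R - rho)) =
    rho + 2 * rho ^+ 2 / (n%:R - 2 * rho).
    by field; rewrite !gt_eqF//; lra.
  have -> : r + e = rho + e / 2 by rewrite /rho; field.
  rewrite lerD2l ler_pdivrMr; last lra.
  have : 4 * rho ^+ 2 / e <= n%:R - 2 * rho by apply: ltW; rewrite /b in bn; lra.
  by rewrite ler_pdivrMr//; lra.
Qed.

Section BallConvexity.
Context {R : realType} {X : normedModType R} (Omega : set X) (r : R).
Hypothesis hX : uniformly_convex (fun x : X => `|x|).
Hypotheses (oO : open Omega) (b0 : boundary Omega !=set0).
Hypotheses (cO : has_segments Omega) (sO : symmetric_set Omega).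
Hypotheses (O0 : Omega 0) (r0 : 0 < r).
Local Notation d := (boundary_dist Omega).
Local Notation B := (quasihyperbolic_ball Omega r).
Implicit Types (p q : nat -> X) (n i : nat) (c : R).

Let d0 : 0 < d 0 := boundary_dist_gt0 oO b0 O0.

Lemma ball_chain x n c (rho : R) : B x -> r < rho -> 0 < c ->
  rho <= n%:R * (c / (1 + c)) -> exists p, [/\ fine_chain Omega c p, p 0%N = 0 & p n = x].
Proof.
move=> [_ kx] rrho c0 rn.
have [|p [p0 pn pO pc]] := quasihyperbolic_chain oO b0 _ c0 rn (x := 0) (y := x).
  by apply: le_lt_trans kx _; rewrite lte_fin.
by exists p.
Qed.

Lemma ball_of_chains x :
  (forall e, 0 < e <= 1 -> exists n c p, [/\ (0 < n)%N, 0 <= c < 1,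
     fine_chain Omega c p, (p 0%N = 0 /\ p n = x) & n%:R * c / (1 - c) <= r + e]) ->
  B x.
Proof.
move=> H; split.
  by have [|n [c [p [_ _ [pO _] [_ <-] _]]]] := H 1; rewrite ?lexx ?ltr01.
apply/lee_addgt0Pr => e e0.
have e1 : 0 < Num.min e 1 <= 1 by rewrite lt_min e0 ltr01 ge_min lexx orbT.
have [n [c [p [n0 /andP[c0 c1] [pO pc] [p0 pn] nc]]]] := H _ e1.
case: n n0 pn nc => [//|n] _ pn nc.
have := quasihyperbolic_le_chain oO b0 (p := p) (w := fun=> c) (n := n).
rewrite p0 pn => /(_ (fun i _ => pO i) (fun i _ => conj (pc i) c1)).
move=> /le_trans; apply.
rewrite -EFinD lee_fin big_const_nat subn0 iter_addr_0 -mulr_natl mulrA.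
by apply: le_trans nc _; rewrite lerD2l ge_min lexx.
Qed.

Lemma ball_convex x y (t : R) : 0 <= t <= 1 -> B x -> B y -> B (t *: x + (1 - t) *: y).
Proof.
move=> t01 Bx By; apply: ball_of_chains => e e1.
have [n [c [rho [[n0 rrho /andP[c0 c2]] [rn nc nce]]]]] := fine_parameters r0 e1.
have [p [fp p0 pn]] := ball_chain Bx rrho c0 rn.
have [q [fq q0 qn]] := ball_chain By rrho c0 rn.
exists n, c, (fun i => t *: p i + (1 - t) *: q i); split => //.
- by rewrite (ltW c0)/=; lra.
- exact: (fine_chain_conv oO b0 cO t01 (ltW c0) fp fq).
- by rewrite p0 q0 pn qn !scaler0 addr0.
Qed.

Lemma ball_symmetric x : B x -> B (- x).
Proof.
move=> Bx; apply: ball_of_chains => e e1.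
have [n [c [rho [[n0 rrho /andP[c0 c2]] [rn nc nce]]]]] := fine_parameters r0 e1.
have [p [fp p0 pn]] := ball_chain Bx rrho c0 rn.
exists n, c, (fun i => - p i); split => //.
- by rewrite (ltW c0)/=; lra.
- exact: (fine_chain_opp b0 sO fp).
- by rewrite p0 pn oppr0.
Qed.

Lemma ball_small x : `|x| <= r / (1 + r) * d 0 -> B x.
Proof.
move=> xr; have r1 : 0 < 1 + r by apply: addr_gt0.
have w1 : r / (1 + r) < 1 by rewrite ltr_pdivrMr//; lra.
have Ox : Omega x.
  apply: (boundary_dist_ball oO O0); rewrite sub0r normrN.
  by apply: le_lt_trans xr _; rewrite gtr_pMl.
split => //.
have := quasihyperbolic_le_chain oO b0 (p := fun i => if i is 0%N then 0 else x)
   (w := fun=> r / (1 + r)) (n := 0%N).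
rewrite big_nat1 (_ : r / (1 + r) / (1 - r / (1 + r)) = r); last first.
  by field; rewrite addrK oner_eq0 gt_eqF.
by apply => [[|i] _|[|i] //]; [exact: O0|exact: Ox|rewrite subr0].
Qed.

Let A := 2 * (r + 1).
Lemma ball_bounded x : B x -> `|x| <= A * (expR A * d 0).
Proof.
move=> Bx.
have [|n [c [rho [[n0 rrho /andP[c0 c2]] [rn nc nce]]]]] := @fine_parameters _ r 1 r0.
  by rewrite ltr01 lexx.
have [p [fp p0 <-]] := ball_chain Bx rrho c0 rn.
by have := fine_chain_norm oO b0 (ltW c0) nc fp; rewrite p0 subr0.
Qed.

(** The gain eta of the midpoint chain pays for one more step, from the midpoint
    m to (1 + delta) m, of relative size at most W = min(1/2, eta/4), that is, of
    cost at most W / (1 - W) <= eta / 2.  The other half of eta absorbs the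
    difference between chains and curves. *)
Lemma ball_midpoint (eps : R) : 0 < eps -> exists2 delta : R, 0 < delta &
  forall x y, B x -> B y -> eps <= `|x - y| -> B ((1 + delta) *: (2^-1 *: (x + y))).
Proof.
move=> e0; have A0 : 0 < A by rewrite mulr_gt0// addr_gt0.
have [eta eta0 gain] := midpoint_chain_gain hX oO b0 cO O0 A0 e0.
pose W := Num.min (2^-1) (eta / 4).
have W0 : 0 < W by rewrite lt_min; apply/andP; split; lra.
have W2 : W <= 2^-1 by rewrite ge_min lexx.
have We : W <= eta / 4 by rewrite ge_min lexx orbT.
pose D := expR A * d 0; pose dm := expR (- (2 * A)) * d 0.
have D0 : 0 < D by rewrite mulr_gt0 ?expR_gt0.
have dm0 : 0 < dm by rewrite mulr_gt0 ?expR_gt0.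
pose delta := W * dm / (A * D).
have delta0 : 0 < delta by rewrite divr_gt0// mulr_gt0.
exists delta => // x y Bx By xy.
have e1 : 0 < Num.min 1 (eta / 2) <= 1.
  by rewrite lt_min ltr01 divr_gt0// ge_min lexx.
have [n [c [rho [[n0 rrho c02] [rn nc nce]]]]] := fine_parameters r0 e1.
have /andP[c0 c2] := c02.
have [p [fp p0 pn]] := ball_chain Bx rrho c0 rn.
have [q [fq q0 qn]] := ball_chain By rrho c0 rn.
have [|w [Hw Sw]] := gain n c p q c02 nc fp fq p0 q0; first by rewrite pn qn.
pose m i := 2^-1 *: (p i + q i).
have fm : fine_chain Omega c m by apply: fine_chain_midpoint => //; exact: ltW.
have m0 : m 0%N = 0 by rewrite /m p0 q0 addr0 scaler0.
have mn : m n = 2^-1 *: (x + y) by rewrite /m pn qn.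
pose m' i := if (i <= n)%N then m i else (1 + delta) *: m n.
have last_step : `|(1 + delta) *: m n - m n| <= W * d (m n).
  rewrite scalerDl scale1r addrC addKr normrZ gtr0_norm//.
  have H1 := fine_chain_norm oO b0 (ltW c0) nc fm; rewrite m0 subr0 in H1.
  have c02' : 0 <= c <= 2^-1 by rewrite ltW.
  have := fine_chain_dist_ge oO b0 c02' nc (leqnn n) fm; rewrite m0 => H2.
  apply: le_trans (_ : W * dm <= _); last by rewrite ler_pM2l.
  have AD0 : 0 < A * D by exact: mulr_gt0.
  have WM0 : 0 < W * dm by exact: mulr_gt0.
  by rewrite /delta mulrAC ler_pdivrMr// ler_pM2l.
have Olast : Omega ((1 + delta) *: m n).
  apply: (boundary_dist_ball oO (fm.1 n)); rewrite distrC.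
  apply: le_lt_trans last_step _; rewrite gtr_pMl; first lra.
  exact: boundary_dist_gt0 oO b0 (fm.1 n).
rewrite -mn; split => //.
have := quasihyperbolic_le_chain oO b0 (p := m') (n := n)
   (w := fun i => if (i < n)%N then w i else W).
rewrite [m' 0%N]/m' leq0n m0 [m' n.+1]/m' ltnn => H; apply: le_trans (H _ _) _.
- by move=> i _; rewrite /m'; case: ifP => // _; exact: fm.1.
- move=> i; rewrite leq_eqVlt => /predU1P[->|ni].
    by rewrite /m' ltnn leqnn; split => //; lra.
  have [H1 /andP[w0 wc]] := Hw _ ni.
  by rewrite /m' ni ltnW//; split => //; lra.
rewrite lee_fin big_nat_recr//= ltnn.
have c1 : 0 < 1 - c by lra.
have : \sum_(0 <= i < n) (if (i < n)%N then w i else W) /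
    (1 - (if (i < n)%N then w i else W))
   <= \sum_(0 <= i < n) w i / (1 - c).
  rewrite big_nat [leRHS]big_nat; apply: ler_sum => i /andP[_ ni]; rewrite ni.
  have [_ /andP[w0 wc]] := Hw _ ni.
  by rewrite ler_wpM2l// lef_pV2 ?posrE; lra.
rewrite -mulr_suml.
have : (\sum_(0 <= i < n) w i) / (1 - c) <= (n%:R * c - eta) / (1 - c).
  by rewrite ler_pM2r ?invr_gt0.
rewrite (mulrBl _ _ eta).
have : eta <= eta / (1 - c) by rewrite ler_pdivlMr// ler_piMr ?ltW//; lra.
have : W / (1 - W) <= 2 * W by rewrite ler_pdivrMr; [nra|lra].
have : Num.min 1 (eta / 2) <= eta / 2 by rewrite ge_min lexx orbT.
lra.
Qed.

End BallConvexity.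

(** * The norms of quasihyperbolic balls *)

Section QuasihyperbolicBallNorm.
Context {R : realType} {X : normedModType R}.
Hypothesis hX : uniformly_convex (fun x : X => `|x|).

Lemma symmetric_convex_domain0 (Omega : set X) : boundary Omega !=set0 ->
  symmetric_set Omega -> has_segments Omega -> Omega 0.
Proof.
move=> [z [cz _]] sO cO.
have [x [Ox _]] := cz setT filterT.
have ONx : Omega (- x) by rewrite -sO; exists x.
have h01 : 0 <= (2^-1 : R) <= 1 by lra.
by have := cO _ _ _ h01 Ox ONx; rewrite midpoint_conv subrr scaler0.
Qed.

(** The ball is symmetric, convex, bounded and a neighbourhood of 0, which makes
    M an equivalent norm; its uniform convexity is [ball_midpoint]. *)
Lemma quasihyperbolic_ball_norm (Omega : set X) (r : R) :
  domain Omega -> symmetric_set Omega -> convex_set Omega -> 0 < r ->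
  let M := minkowski_functional (quasihyperbolic_ball Omega r) in
  equivalent_norm M /\ uniformly_convex M.
Proof.
move=> [oO _ b0] sO /convex_set_segments cO r0 M.
have O0 := symmetric_convex_domain0 b0 sO cO.
have d0 := boundary_dist_gt0 oO b0 O0.
have a0 : 0 < r / (1 + r) * boundary_dist Omega 0.
  by rewrite mulr_gt0// divr_gt0//; lra.
have A0 : 0 < 2 * (r + 1) * (expR (2 * (r + 1)) * boundary_dist Omega 0).
  by rewrite !mulr_gt0 ?expR_gt0//; lra.
have small := ball_small oO b0 O0 r0.
have bounded := ball_bounded oO b0 r0.
have cvx := ball_convex oO b0 cO r0.
have sym := ball_symmetric oO b0 sO r0.
split; first exact: (minkowski_equivalent_norm a0 A0 small bounded cvx sym).
apply: (minkowski_uniformly_convex a0 small cvx).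
exact: ball_midpoint.
Qed.

End QuasihyperbolicBallNorm.

Section NormUnitBall.
Context {R : realType} {X : normedModType R} (N : X -> R) (c C : R).
Hypothesis nN : is_norm N.
Hypotheses (c0 : 0 < c) (C0 : 0 < C).
Hypothesis NcC : forall x, c * `|x| <= N x <= C * `|x|.
Hypothesis X0 : exists x : X, x != 0.

Definition norm_ball : set X := [set x | N x < 1].
Local Notation Omega := norm_ball.

Let Nadd x y : N (x + y) <= N x + N y. Proof. by have [] := nN. Qed.
Let Nscale (a : R) x : N (a *: x) = `|a| * N x. Proof. by have [] := nN. Qed.
Let Nlip x y : N y <= N x + C * `|x - y|.
Proof.
rewrite -{1}(subrK x y) addrC; apply: le_trans (Nadd _ _) _.
by rewrite lerD2l distrC; have /andP[] := NcC (y - x).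
Qed.

Lemma norm_ball_open : open Omega.
Proof.
rewrite openE => x Ox; apply/nbhs_ballP.
have e0 : 0 < (1 - N x) / C by rewrite divr_gt0// subr_gt0.
exists ((1 - N x) / C) => //= y; rewrite -ball_normE/= ltr_pdivlMr// => xy.
by rewrite /norm_ball/=; have := Nlip x y; lra.
Qed.

Lemma norm_ball_segments : has_segments Omega.
Proof.
move=> x y t /andP[t0 t1] Ox Oy; rewrite /norm_ball/= in Ox Oy *.
apply: le_lt_trans (Nadd _ _) _; rewrite !Nscale !ger0_norm ?subr_ge0//.
have : t * N x <= t * Num.max (N x) (N y) by rewrite ler_wpM2l// le_max lexx.
have : (1 - t) * N y <= (1 - t) * Num.max (N x) (N y).
  by rewrite ler_wpM2l ?subr_ge0// le_max lexx orbT.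
have : Num.max (N x) (N y) < 1 by rewrite gt_max Ox.
lra.
Qed.

Lemma norm_ball_symmetric : symmetric_set Omega.
Proof.
have NN x : N (- x) = N x by rewrite -scaleN1r Nscale normrN1 mul1r.
apply/seteqP; split=> [_ [x Ox <-]|x Ox]; first by rewrite /norm_ball/= NN.
by exists (- x); rewrite ?opprK// /norm_ball/= NN.
Qed.

(** The boundary contains every vector z of norm 1, which is the limit of its
    multiples by |z| / (e + |z|) as e tends to 0. *)
Lemma norm_ball_boundary : boundary Omega !=set0.
Proof.
have [x x0] := X0; have nx : 0 < `|x| by rewrite normr_gt0.
have Nx : 0 < N x by have /andP[+ _] := NcC x; apply: lt_le_trans; exact: mulr_gt0.
pose z := (N x)^-1 *: x.
have Nz : N z = 1 by rewrite Nscale gtr0_norm ?invr_gt0// mulVf// gt_eqF.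
have z0 : 0 < `|z| by rewrite normrZ mulr_gt0// normr_gt0 invr_eq0 gt_eqF.
exists z; split; last by move=> /interior_subset; rewrite /norm_ball/= Nz ltxx.
move=> U /nbhs_ballP[e /= e0 zU].
have ez : 0 < e + `|z| by exact: addr_gt0.
exists ((`|z| / (e + `|z|)) *: z); split.
  rewrite /norm_ball/= Nscale Nz mulr1 ger0_norm ?divr_ge0 ?(ltW ez)//.
  by rewrite ltr_pdivrMr// mul1r ltrDr.
apply: zU; rewrite -ball_normE/=.
have -> : z - (`|z| / (e + `|z|)) *: z = (e / (e + `|z|)) *: z.
  by rewrite -{1}[z]scale1r -scalerBl; congr (_ *: _); field; rewrite gt_eqF.
rewrite normrZ gtr0_norm ?divr_gt0// mulrAC ltr_pdivrMr// mulrDr ltrDr.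
exact: mulr_gt0.
Qed.

Lemma norm_ball_domain : domain Omega.
Proof.
split; [exact: norm_ball_open| |exact: norm_ball_boundary].
move=> x y Ox Oy; exists (fun t : R => t *: y + (1 - t) *: x); split.
- apply: continuous_subspaceT => t; apply: cvgD.
    by apply: cvgZr_tmp; exact: cvg_id.
  by apply: cvgZr_tmp; apply: cvgB; [exact: cvg_cst|exact: cvg_id].
- by rewrite scale0r add0r subr0 scale1r.
- by rewrite scale1r subrr scale0r addr0.
- by move=> _ [t /= t01 <-]; rewrite in_itv/= in t01; exact: norm_ball_segments.
Qed.

Lemma norm_ball_dist (eta : R) x : N x <= 1 - eta -> eta / C <= boundary_dist Omega x.
Proof.
move=> Nx; apply: (boundary_dist_ge norm_ball_boundary) => w.
move=> /(boundary_notin norm_ball_open)/negP; rewrite /norm_ball/= -leNgt => Nw.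
by rewrite ler_pdivrMr//; have := Nlip x w; lra.
Qed.

(** Along the segment from 0 to x the distance to the boundary is at least
    eta / C, and |x| <= 1 / c.  The segment is divided into so many equal steps
    that each is at most half of that distance; the factor 2 is the resulting
    bound on 1 / (1 - w). *)
Lemma norm_ball_quasihyperbolic (eta : R) x : 0 < eta <= 1 -> N x <= 1 - eta ->
  quasihyperbolic_ball Omega (2 * (C / (c * eta))) x.
Proof.
move=> /andP[e0 e1] Nx; set K := C / (c * eta).
have K0 : 0 < K by rewrite divr_gt0// mulr_gt0.
have Ox : Omega x by rewrite /norm_ball/=; lra.
split => //.
have K20 : 0 <= 2 * K by lra.
have nK := archi_boundP K20; set n := Num.bound _ in nK.
have n0 : 0 < n.+1%:R :> R by rewrite ltr0n.
have Kn : K / n.+1%:R <= 2^-1.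
  by rewrite ler_pdivrMr// -[n.+1%:R]natr1; move: nK; clearbody K; lra.
pose p i : X := (i%:R / n.+1%:R) *: x.
have Np i : (i <= n.+1)%N -> N (p i) <= 1 - eta.
  move=> ni; rewrite Nscale ger0_norm ?divr_ge0 ?(ltW n0)//.
  have Nx0 : 0 <= N x by have /andP[+ _] := NcC x; apply: le_trans; rewrite mulr_ge0// ltW.
  by apply: le_trans Nx; rewrite ler_piMl// ler_pdivrMr// mul1r ler_nat.
have := quasihyperbolic_le_chain norm_ball_open norm_ball_boundary (p := p) (n := n)
   (w := fun=> K / n.+1%:R).
have -> : p 0%N = 0 by rewrite /p mul0r scale0r.
have -> : p n.+1 = x by rewrite /p divff ?scale1r// gt_eqF.
move=> H.
apply: le_trans (H _ _) _.
- by move=> i /Np Npi; rewrite /norm_ball/=; lra.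
- move=> i ni; split; last by apply: le_lt_trans Kn _; lra.
  have dp := norm_ball_dist (Np _ (leqW ni)).
  rewrite /p -scalerBl -mulrBl -natr1 addrAC subrr add0r mul1r normrZ gtr0_norm ?invr_gt0//.
  rewrite [K / _]mulrC -mulrA ler_pM2l ?invr_gt0//.
  apply: le_trans (_ : K * (eta / C) <= _); last by rewrite ler_pM2l.
  have -> : K * (eta / C) = c^-1 by rewrite /K; field; rewrite !gt_eqF.
  rewrite -(ler_pM2l c0) divff ?gt_eqF//.
  by have /andP[+ _] := NcC x; lra.
rewrite lee_fin big_const_nat subn0 iter_addr_0 -[leLHS]mulr_natl.
have nw : n.+1%:R * (K / n.+1%:R) = K by rewrite mulrCA divff ?mulr1// gt_eqF.
rewrite mulrA nw; move: (K / _) Kn => w w2.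
have w1 : 0 < 1 - w by lra.
by rewrite ler_pdivrMr// [2 * K]mulrC -mulrA ler_peMr ?(ltW K0)//; lra.
Qed.

(** The quasihyperbolic ball contains the vectors with N <= 1 - eta and is
    contained in the unit ball of N. *)
Lemma minkowski_norm_ball (eta : R) x : 0 < eta <= 2^-1 ->
  N x <= minkowski_functional (quasihyperbolic_ball Omega (2 * (C / (c * eta)))) x
      <= N x / (1 - eta).
Proof.
move=> /andP[e0 e2].
have e01 : 0 < eta <= 1 by rewrite e0/=; lra.
have e1 : 0 < 1 - eta by lra.
have Nx0 : 0 <= N x by have /andP[+ _] := NcC x; apply: le_trans; rewrite mulr_ge0// ltW.
have Ne0 : 0 <= N x / (1 - eta) by rewrite divr_ge0// ltW.
have up l : 0 < l -> N x / (1 - eta) <= l ->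
    quasihyperbolic_ball Omega (2 * (C / (c * eta))) (l^-1 *: x).
  move=> l0 Nl; apply: norm_ball_quasihyperbolic => //.
  by rewrite Nscale gtr0_norm ?invr_gt0// ler_pdivrMl// -ler_pdivrMr.
apply/andP; split; last first.
  apply/ler_addgt0Pr => e e_gt0.
  have l0 : 0 < N x / (1 - eta) + e by lra.
  by apply: minkowski_le => //; apply: up => //; rewrite lerDl ltW.
apply: lb_le_inf.
  have l0 : 0 < N x / (1 - eta) + 1 by lra.
  exists (N x / (1 - eta) + 1); split => //.
  exists ((N x / (1 - eta) + 1)^-1 *: x).
    by apply: up => //; lra.
  by rewrite scalerA divff ?scale1r// gt_eqF.
move=> l [l0 [y [Oy _] <-]]; rewrite Nscale gtr0_norm// ger_pMr// ltW//.
Qed.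

End NormUnitBall.

Unset Implicit Arguments.

Theorem theorem4p3 (R : realType) (X : completeNormedModType R)
    (hX : uniformly_convex (fun x : X => `|x|)) :
  (forall (Omega : set X) (r : R),
     domain Omega -> symmetric_set Omega -> convex_set Omega -> 0 < r ->
     let M := minkowski_functional (quasihyperbolic_ball Omega r) in
     equivalent_norm M /\ uniformly_convex M)
  /\
  ((exists x : X, x != 0) ->
   forall (N : X -> R) (S : set X) (eps : R),
     equivalent_norm N -> bounded_set S -> 0 < eps ->
     exists (Omega : set X) (r : R),
       [/\ domain Omega, symmetric_set Omega, convex_set Omega & 0 < r] /\
       let M := minkowski_functional (quasihyperbolic_ball Omega r) in
       [/\ equivalent_norm M, uniformly_convex M
         & (ereal_sup [set `|M x - N x|%:E | x in S] <= eps%:E)%E]).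
Proof.
split; first by move=> Omega r; exact: quasihyperbolic_ball_norm.
move=> X0 N S eps [nN [c [C [c0 C0 NcC]]]] [b0 [_ Sb]] e0.
pose b := Num.max b0 0 + 1.
have b_gt0 : 0 < b by rewrite ltr_wpDl// le_max lexx orbT.
have {}Sb x : S x -> `|x| <= b.
  by apply: Sb; rewrite /b; have : b0 <= Num.max b0 0; [rewrite le_max lexx|lra].
(* On S the norm N is at most C b, and M exceeds N by a factor at most
   1 / (1 - eta) <= 1 + 2 eta. *)
pose eta := Num.min (2^-1) (eps / (2 * C * b)).
have Cb0 : 0 < 2 * C * b by rewrite !mulr_gt0.
have eta2 : 0 < eta <= 2^-1 by rewrite lt_min invr_gt0 ltr0n divr_gt0//= ge_min lexx.
have etab : eta <= eps / (2 * C * b) by rewrite ge_min lexx orbT.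
have /andP[eta0 eta1] := eta2.
have dO := norm_ball_domain nN c0 C0 NcC X0.
have sO := norm_ball_symmetric nN.
have cO := (convex_set_segments _).2 (norm_ball_segments nN).
have r0 : 0 < 2 * (C / (c * eta)) by rewrite mulr_gt0// divr_gt0// mulr_gt0.
exists (norm_ball N), (2 * (C / (c * eta))); split => // M.
have [eM uM] := quasihyperbolic_ball_norm hX dO sO cO r0.
split => //; apply: ge_ereal_sup => _ [x Sx <-]; rewrite lee_fin.
have /andP[NM MN] := minkowski_norm_ball nN c0 C0 NcC X0 x eta2.
rewrite ger0_norm ?subr_ge0//.
have e1 : 0 < 1 - eta by lra.
rewrite lerBlDl; apply: le_trans MN _; rewrite ler_pdivrMr//.
have /andP[_ NC] := NcC x.
have NCb : N x <= C * b by apply: le_trans NC _; rewrite ler_pM2l// Sb.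
have : eta * N x <= eta * (C * b) by rewrite ler_pM2l.
move: etab; rewrite ler_pdivlMr// => etab.
have : eps * eta <= eps * 2^-1 by rewrite ler_pM2l.
lra.
Qed.
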